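(* Let $\varepsilon,\gamma,\gamma'\in(0,1]$ with $\gamma>\gamma'$. There is an $\varepsilon$-$\nabla_0$DP algorithm $M:\mathcal{X}^n\to\mathcal{H}_{\mathrm{halfspace}}$, where $\mathcal{X}=\{-1,+1\}^d\times\{-1,+1\}$, such that for every distribution $\mathcal{D}$ on $\mathcal{X}$, if $S\sim\mathcal{D}^n$ then $$\mathbb{E}[\mathcal{R}_{\gamma'}(M(S),\mathcal{D})]\le\inf_{h\in\mathcal{H}_{\mathrm{halfspace}}}\mathcal{R}_\gamma(h,\mathcal{D})+O\!\left(\frac{1}{\varepsilon\sqrt n(\gamma-\gamma')^2}+\frac{\log(1/(\gamma-\gamma'))}{\varepsilon^2n(\gamma-\gamma')}\right),$$ where the $O(\cdot)$ hides an absolute constant.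
   Context: A halfspace is $h_w(x)=\mathrm{sgn}(\langle w,x\rangle)$ for $w\in\mathbb{R}^d$; $\mathcal{H}_{\mathrm{halfspace}}=\{h_w:w\in\mathbb{R}^d\}$. For a distribution $\mathcal{D}$ on $\{-1,+1\}^d\times\{-1,+1\}$ and $h:\{-1,+1\}^d\to\{-1,+1\}$, the $\gamma$-robust error is $\mathcal{R}_\gamma(h,\mathcal{D})=\Pr_{(x,y)\sim\mathcal{D}}[\exists\check x\in\{-1,+1\}^d:\ h(\check x)\ne y\ \wedge\ \|\check x-x\|_0\le\gamma d]$, where $\|\cdot\|_0$ is Hamming distance. For privacy, each record $(x_i,y_i)$ is viewed as having $d+1$ attributes (coordinates of $x_i$ and the label); $M$ is $\varepsilon$-$\nabla_0$DP if for all datasets $S,S'$ differing only in record $i$ and all measurable sets $E$, $\Pr[M(S)\in E]\le e^{\varepsilon\cdot k}\Pr[M(S')\in E]$, where $k$ is the number of attributes on which records $i$ of $S$ and $S'$ differ. *)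

(* Defs.v *)
From HB Require Import structures.
From mathcomp Require Import all_boot all_order all_algebra.
From mathcomp Require Import all_classical all_reals all_analysis.
Set Implicit Arguments. Unset Strict Implicit. Unset Printing Implicit Defensive.
Import Order.TTheory GRing.Theory Num.Theory.
Local Open Scope ring_scope.

(* Signs {-1,+1} are encoded as bool: true = +1, false = -1. *)
Definition sgnval {R : nzRingType} (b : bool) : R := if b then 1 else -1.

Notation cube d := {ffun 'I_d -> bool}.
Notation record d := (cube d * bool)%type.
Notation hyp d := {ffun cube d -> bool}.

Definition hamming (d : nat) (x x' : cube d) : nat := #|[set i | x i != x' i]|.

Definition rec_dist (d : nat) (r r' : record d) : nat :=
  (hamming r.1 r'.1 + (r.2 != r'.2))%N.

Definition inner {R : nzRingType} (d : nat) (w : 'I_d -> R) (x : cube d) : R :=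
  \sum_(i < d) w i * sgnval (x i).

Definition halfspace {R : realDomainType} (d : nat) (w : 'I_d -> R) : hyp d :=
  [ffun x => 0 <= inner w x].

Definition is_halfspace (R : realDomainType) (d : nat) (h : hyp d) : Prop :=
  exists w : 'I_d -> R, h = halfspace w.

Definition is_pmf {R : numDomainType} {T : finType} (P : {ffun T -> R}) : Prop :=
  (forall t, 0 <= P t) /\ \sum_t P t = 1.

Definition robust_err {R : realFieldType} (d : nat) (gamma : R) (h : hyp d)
  (D : {ffun record d -> R}) : R :=
  \sum_(r : record d)
     D r * (if [exists xc : cube d, (h xc != r.2) && ((hamming xc r.1)%:R <= gamma * d%:R)]
            then 1 else 0).

(* A randomized algorithm M : X^n -> H_halfspace, given by its output
   distribution (on the finite set of functions {-1,+1}^d -> {-1,+1}),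
   supported on halfspaces. *)
Definition mechanism (R : realDomainType) (d n : nat) :=
  n.-tuple (record d) -> {ffun hyp d -> R}.

Definition valid_halfspace_mech (R : realDomainType) (d n : nat) (M : mechanism R d n) : Prop :=
  forall S, is_pmf (M S) /\ forall h, M S h != 0 -> is_halfspace R h.

Definition prob_in (R : realDomainType) (d n : nat) (M : mechanism R d n)
  (S : n.-tuple (record d)) (E : {set hyp d}) : R := \sum_(h in E) M S h.

Definition nabla0_DP (R : realType) (d n : nat) (eps : R) (M : mechanism R d n) : Prop :=
  forall (S S' : n.-tuple (record d)) (i : 'I_n),
    (forall j, j != i -> tnth S j = tnth S' j) ->
    forall E : {set hyp d},
      prob_in M S E <= expR (eps * (rec_dist (tnth S i) (tnth S' i))%:R) * prob_in M S' E.

Definition expected_robust_err (R : realType) (d n : nat) (M : mechanism R d n)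
  (gamma' : R) (D : {ffun record d -> R}) : R :=
  \sum_(S : n.-tuple (record d))
     (\prod_(i < n) D (tnth S i)) * \sum_(h : hyp d) M S h * robust_err gamma' h D.

(* Main.v *)
(** Each label is passed through randomized response with bias [eta = eps / 3] and the
    loss is debiased accordingly, at the price of a factor [1 / eta]; a halfspace is then
    drawn with probability proportional to [exp (- la * empirical loss)].  Changing a
    label costs [eps] through the randomized response only, so the exponential mechanism
    need only be stable in the coordinates of the points, and it gains from a loss whose
    change per coordinate is [O(1 / d)].

    Put [Dl = gamma - gamma'] and [u = 1 / (eps sqrt n)]; the bound is trivial unless
    [u <= Dl ^ 2], so an excess [O(u / Dl ^ 2)] suffices.  If [d * Dl < 3], Chow parameters
    show that there are only [exp (O(d ^ 2))] halfspaces, and a union bound is enough.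
    Otherwise one uses integer weights in [-m, m] with [m = O(1 / Dl ^ 2)], together with
    the constant [true]: truncating the largest weights of a halfspace that is
    [gamma]-robust somewhere, rescaling and rounding costs only robustness radius, and
    leaves a margin of order [d] times the unit weight under [gamma' d] flips.  The loss is
    a ramp of this robust margin.  The robust margin is not linear in the point, but
    summing over the levels of the weights it is a linear form minus a sum of functions
    [min (k, linear)], so symmetrization and two rounds of contraction bound the
    generalization gap by [O(u / Dl ^ 2)] independently of [d]. *)
Require Import Defs.
From HB Require Import structures.
From mathcomp Require Import all_boot all_order all_algebra.
From mathcomp Require Import all_classical all_reals all_analysis.
From mathcomp Require Import ring lra zify.
Set Implicit Arguments. Unset Strict Implicit. Unset Printing Implicit Defensive.
Import Order.TTheory GRing.Theory Num.Theory.
Local Open Scope ring_scope.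

(** * Rademacher processes over a finite class *)

Section EmpiricalProcess.
Variable R : realType.
Implicit Types T : finType.

Definition Ex T (D : T -> R) n (F : n.-tuple T -> R) : R :=
  \sum_(S : n.-tuple T) (\prod_(i < n) D (tnth S i)) * F S.

Lemma Ex_nil T (D : T -> R) (F : 0.-tuple T -> R) : Ex D F = F [tuple].
Proof.
rewrite /Ex (bigD1 [tuple]) //= big_ord0 mul1r big1 ?addr0 // => S /eqP[].
exact: tuple0.
Qed.

Lemma sum_tuple_cons T n (F : n.+1.-tuple T -> R) :
  \sum_S F S = \sum_s \sum_(S : n.-tuple T) F (cons_tuple s S).
Proof.
rewrite pair_big /= (reindex (fun p : T * n.-tuple T => cons_tuple p.1 p.2)) //=.
exists (fun S => (thead S, behead_tuple S)) => [[s S] _|S _] /=.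
  by congr pair; apply: val_inj.
by rewrite [RHS]tuple_eta; apply: val_inj.
Qed.

Lemma Ex_cons T (D : T -> R) n (F : n.+1.-tuple T -> R) :
  Ex D F = \sum_s D s * Ex D (fun S : n.-tuple T => F (cons_tuple s S)).
Proof.
rewrite /Ex sum_tuple_cons; apply: eq_bigr => s _; rewrite big_distrr.
apply: eq_bigr => S _ /=; rewrite big_ord_recl tnth0 mulrA.
by congr (_ * _ * _); apply: eq_bigr => i _; rewrite tnthS.
Qed.

Lemma ler_Ex T (D : T -> R) n (F G : n.-tuple T -> R) :
  (forall s, 0 <= D s) -> (forall S, F S <= G S) -> Ex D F <= Ex D G.
Proof. by move=> D0 FG; apply: ler_sum => S _; apply: ler_wpM2l => //; apply: prodr_ge0. Qed.

Lemma eq_Ex T (D : T -> R) n (F G : n.-tuple T -> R) : F =1 G -> Ex D F = Ex D G.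
Proof. by move=> FG; apply: eq_bigr => S _; rewrite FG. Qed.

Lemma ExD T (D : T -> R) n (F G : n.-tuple T -> R) :
  Ex D (fun S => F S + G S) = Ex D F + Ex D G.
Proof. by rewrite /Ex -big_split; apply: eq_bigr => S _; rewrite mulrDr. Qed.

Lemma ExZ T (D : T -> R) n c (F : n.-tuple T -> R) :
  Ex D (fun S => c * F S) = c * Ex D F.
Proof. by rewrite /Ex big_distrr; apply: eq_bigr => S _; rewrite mulrCA. Qed.

Lemma Ex_cst T (D : T -> R) n c : \sum_s D s = 1 -> @Ex T D n (fun=> c) = c.
Proof.
move=> D1; elim: n => [|n IHn]; first by rewrite Ex_nil.
by rewrite Ex_cons; under eq_bigr do rewrite IHn; rewrite -big_distrl /= D1 mul1r.
Qed.

Lemma Ex_sum T (D : T -> R) n (f : T -> R) : \sum_s D s = 1 ->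
  Ex D (fun S : n.-tuple T => \sum_(i < n) f (tnth S i)) = n%:R * \sum_s D s * f s.
Proof.
move=> D1; elim: n => [|n IHn]; first by rewrite Ex_nil big_ord0 mul0r.
rewrite Ex_cons.
transitivity (\sum_s (D s * f s + D s * (n%:R * \sum_s D s * f s))); last first.
  by rewrite big_split -big_distrl /= D1 mul1r -natr1 mulrDl mul1r addrC.
apply: eq_bigr => s _; rewrite -IHn -mulrDr; congr (_ * _).
rewrite -[X in X + _](Ex_cst n (f s) D1) -ExD; apply: eq_Ex => S.
by rewrite big_ord_recl tnth0; congr (_ + _); apply: eq_bigr => i _; rewrite tnthS.
Qed.

(** * Expected suprema: symmetrization, contraction and a maximal inequality *)

Section Sup.
Variables (H : finType) (h0 : H).
Implicit Types (a : H -> R) (Phi : (H -> R) -> R).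

Definition maxv a : R := a [arg max_(h > h0) a h]%O.

Lemma maxv_ge a h : a h <= maxv a.
Proof. by rewrite /maxv; case: arg_maxP => // i _; apply. Qed.

Lemma maxv_le a c : (forall h, a h <= c) -> maxv a <= c.
Proof. by move=> ac; apply: ac. Qed.

Lemma maxv_ex a : exists h, maxv a = a h.
Proof. by exists [arg max_(h > h0) a h]%O. Qed.

(** One sample is integrated out and its contribution goes into the offset [a]. Expected suprema
    thereby become iterates of an operator ([Ex_iter]), and samples can be treated one at a time. *)
Definition step T (D : T -> R) (G : T -> H -> R) Phi a : R :=
  \sum_s D s * Phi (fun h => a h + G s h).

Lemma Ex_iter T (D : T -> R) (G : T -> H -> R) n a :
  Ex D (fun S : n.-tuple T => maxv (fun h => a h + \sum_(i < n) G (tnth S i) h)) =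
  iter n (step D G) maxv a.
Proof.
elim: n a => [|n IHn] a.
  by rewrite Ex_nil /=; congr maxv; apply/funext => h; rewrite big_ord0 addr0.
rewrite Ex_cons /= /step; apply: eq_bigr => s _; rewrite -IHn; congr (_ * _).
apply: eq_Ex => S; congr maxv; apply/funext => h.
rewrite big_ord_recl tnth0 addrA; congr (_ + _).
by apply: eq_bigr => i _; rewrite tnthS.
Qed.

Lemma ler_step T (D : T -> R) (G : T -> H -> R) Phi Psi a :
  (forall s, 0 <= D s) -> (forall a, Phi a <= Psi a) -> step D G Phi a <= step D G Psi a.
Proof. by move=> D0 PP; apply: ler_sum => s _; apply: ler_wpM2l. Qed.

Lemma stepC T T' (D : T -> R) (G : T -> H -> R) (D' : T' -> R) (G' : T' -> H -> R) Phi a :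
  step D G (step D' G' Phi) a = step D' G' (step D G Phi) a.
Proof.
rewrite /step; under eq_bigr do rewrite big_distrr /=.
rewrite exchange_big; apply: eq_bigr => s' _; rewrite big_distrr /=.
apply: eq_bigr => s _; rewrite mulrCA; congr (_ * (_ * Phi _)).
by apply/funext => h; rewrite addrAC.
Qed.

(* Steps commute, so the samples can be replaced one at a time, each time with the
   other n - 1 samples absorbed in the offset. *)
Lemma iter_step_le T T' (D : T -> R) (G : T -> H -> R) (D' : T' -> R) (G' : T' -> H -> R) n a :
  (forall s, 0 <= D s) -> (forall s, 0 <= D' s) ->
  (forall a, step D G maxv a <= step D' G' maxv a) ->
  iter n (step D G) maxv a <= iter n (step D' G') maxv a.
Proof.
move=> D0 D'0 le1; elim: n a => [//|n IHn] a.
have {IHn} IHn : forall a, step D' G' (iter n (step D G) maxv) a <= iter n.+1 (step D' G') maxv a.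
  by move=> b; apply: ler_step.
apply: le_trans (IHn a).
elim: n a {IHn} => [|n IHn] a; first exact: le1.
rewrite [leRHS]stepC; exact: ler_step.
Qed.

Definition rad T (D : T -> R) (p : T * bool) : R := D p.1 / 2.
Definition signed T (g : T -> H -> R) (p : T * bool) (h : H) : R := sgnval p.2 * g p.1 h.

Lemma rad_ge0 T (D : T -> R) : (forall s, 0 <= D s) -> forall p, 0 <= rad D p.
Proof. by move=> D0 p; rewrite divr_ge0. Qed.

Lemma step_rad T (D : T -> R) g Phi a : step (rad D) (signed g) Phi a =
  \sum_s D s * ((Phi (fun h => a h + g s h) + Phi (fun h => a h - g s h)) / 2).
Proof.
rewrite /step -(pair_bigA _ (fun s b => rad D (s, b) * Phi (fun h => a h + signed g (s, b) h))) /=.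
apply: eq_bigr => s _; rewrite big_bool /= /rad /signed /=.
under [X in Phi X]funext do rewrite mul1r.
under [X in _ + _ * Phi X]funext do rewrite mulN1r.
by rewrite -mulrDr mulrAC mulrA.
Qed.

(** The mean is an average over a ghost sample [t], which Jensen moves out of the maximum. Then
    [a + l t - l s] is the half-sum of [a + 2 l t] and [a - 2 l s], whose maxima are averaged
    separately over [t] and [s]; hence the factor 2. *)
Lemma step_symmetrize T (D : T -> R) (l : T -> H -> R) a :
  (forall s, 0 <= D s) -> \sum_s D s = 1 ->
  step D (fun s h => \sum_t D t * l t h - l s h) maxv a <=
  step (rad D) (signed (fun s h => 2 * l s h)) maxv a.
Proof.
move=> D0 D1; rewrite step_rad /step.
pose P s := maxv (fun h => a h + 2 * l s h); pose Q s := maxv (fun h => a h - 2 * l s h).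
apply: (@le_trans _ _ (\sum_s D s * \sum_t D t * ((P t + Q s) / 2))).
  apply: ler_sum => s _; apply: ler_wpM2l => //; apply: maxv_le => h.
  have -> : a h + (\sum_t D t * l t h - l s h) = \sum_t D t * (a h + (l t h - l s h)).
    under [RHS]eq_bigr do rewrite mulrDr mulrBr.
    by rewrite big_split /= sumrB -!big_distrl /= D1 !mul1r.
  apply: ler_sum => t _; apply: ler_wpM2l => //.
  have := maxv_ge (fun h => a h + 2 * l t h) h; have := maxv_ge (fun h => a h - 2 * l s h) h.
  by rewrite -/(P t) -/(Q s) /=; lra.
have E s : \sum_t D t * ((P t + Q s) / 2) = (\sum_t D t * P t) / 2 + Q s / 2.
  under eq_bigr do rewrite mulrA mulrDr mulrDl.
  by rewrite big_split /= -!big_distrl /= D1 mul1r.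
under eq_bigr do rewrite E mulrDr.
rewrite big_split /= -big_distrl /= D1 mul1r.
have -> : (\sum_t D t * P t) / 2 = \sum_t D t * (P t / 2).
  by rewrite big_distrl; apply: eq_bigr => t _; rewrite mulrA.
by rewrite -big_split; apply: ler_sum => s _ /=; rewrite -mulrDr -mulrDl.
Qed.

(** With [h1] and [h2] maximizing for the two signs of [f], the difference [f s h1 - f s h2] is at
    most the absolute difference for [g]. The sign of the latter decides which of [h1], [h2] to use
    with [+ g] and which with [- g]. *)
Lemma step_contract T (D : T -> R) (f g : T -> H -> R) a :
  (forall s, 0 <= D s) ->
  (forall s h h', `|f s h - f s h'| <= `|g s h - g s h'|) ->
  step (rad D) (signed f) maxv a <= step (rad D) (signed g) maxv a.
Proof.
move=> D0 fg; rewrite !step_rad; apply: ler_sum => s _; apply: ler_wpM2l => //.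
rewrite ler_pM2r ?invr_gt0 //.
have [h1 ->] := maxv_ex (fun h => a h + f s h).
have [h2 ->] := maxv_ex (fun h => a h - f s h).
have := fg s h1 h2; have := ler_norm (f s h1 - f s h2).
have := maxv_ge (fun h => a h + g s h) h1; have := maxv_ge (fun h => a h - g s h) h2.
have := maxv_ge (fun h => a h + g s h) h2; have := maxv_ge (fun h => a h - g s h) h1.
rewrite /=; case: (lerP 0 (g s h1 - g s h2)) => G; rewrite ?(ger0_norm G) ?(ltr0_norm G); lra.
Qed.

(* n times the Rademacher complexity of the class g over n samples of D, when D is a
   probability. *)
Definition Rad T (D : T -> R) (g : T -> H -> R) n : R :=
  iter n (step (rad D) (signed g)) maxv (fun=> 0).

Lemma Rad_symmetrize T (D : T -> R) (l : T -> H -> R) n :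
  (forall s, 0 <= D s) -> \sum_s D s = 1 ->
  Ex D (fun S : n.-tuple T =>
    maxv (fun h => \sum_(i < n) (\sum_t D t * l t h - l (tnth S i) h))) <=
  Rad D (fun s h => 2 * l s h) n.
Proof.
move=> D0 D1; pose G s h := \sum_t D t * l t h - l s h.
have -> : Ex D (fun S : n.-tuple T =>
    maxv (fun h => \sum_(i < n) (\sum_t D t * l t h - l (tnth S i) h)))
    = iter n (step D G) maxv (fun=> 0).
  by rewrite -Ex_iter; apply: eq_Ex => S; congr maxv; apply/funext => h; rewrite add0r.
by apply: iter_step_le => // [|a]; [exact: rad_ge0|exact: step_symmetrize].
Qed.

Lemma Rad_contract T (D : T -> R) (f g : T -> H -> R) n :
  (forall s, 0 <= D s) ->
  (forall s h h', `|f s h - f s h'| <= `|g s h - g s h'|) ->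
  Rad D f n <= Rad D g n.
Proof.
by move=> D0 fg; apply: iter_step_le => [||a]; try exact: rad_ge0; exact: step_contract.
Qed.

Lemma Rad_sum T (D : T -> R) (I : finType) (g : I -> T -> H -> R) n :
  (forall s, 0 <= D s) ->
  Rad D (fun s h => \sum_i g i s h) n <= \sum_i Rad D (g i) n.
Proof.
move=> D0; rewrite /Rad.
(* Each summand gets its own offset, so that the induction can distribute the sampled terms among
   the summands. *)
suff: forall a : I -> H -> R,
  iter n (step (rad D) (signed (fun s h => \sum_i g i s h))) maxv (fun h => \sum_i a i h)
  <= \sum_i iter n (step (rad D) (signed (g i))) maxv (a i).
  move=> /(_ (fun _ _ => 0)); under [X in iter _ _ _ X]funext do rewrite big1_eq.
  exact.
elim: n => [|n IHn] a /=.
  by apply: maxv_le => h; apply: ler_sum => i _; apply: maxv_ge.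
rewrite /step exchange_big /=; apply: ler_sum => p _; rewrite -big_distrr /=.
apply: ler_wpM2l; first exact: rad_ge0.
apply: le_trans (IHn _); rewrite le_eqVlt; apply/orP; left; apply/eqP; congr (iter n _ _ _).
by apply/funext => h; rewrite /signed big_distrr -big_split.
Qed.

Lemma RadD T (D : T -> R) (f g : T -> H -> R) n :
  (forall s, 0 <= D s) ->
  Rad D (fun s h => f s h + g s h) n <= Rad D f n + Rad D g n.
Proof.
move=> D0; have := Rad_sum (fun b : bool => if b then f else g) n D0.
have -> : (fun s h => \sum_b (if b then f else g) s h) = (fun s h => f s h + g s h).
  by apply/funext => s; apply/funext => h; rewrite big_bool.
by rewrite big_bool.
Qed.

(* AM-GM, |c| <= (c^2 / sqrt n + sqrt n) / 2, keeps the bound quadratic in the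
   accumulated coordinates, hence stable under one more Rademacher step. *)
Lemma Rad_linear T (D : T -> R) (Q : finType) (v : Q -> H -> R) (e : Q -> T -> R)
    (V : Q -> R) n :
  (forall s, 0 <= D s) -> \sum_s D s = 1 -> (0 < n)%N ->
  (forall q h, `|v q h| <= V q) -> (forall q s, `|e q s| <= 1) ->
  Rad D (fun s h => \sum_q v q h * e q s) n <= (\sum_q V q) * Num.sqrt n%:R.
Proof.
move=> D0 D1 n0 vV e1; set N : R := Num.sqrt n%:R.
have N0 : 0 < N by rewrite sqrtr_gt0 ltr0n.
have NN : N * N = n%:R by rewrite -expr2 sqr_sqrtr.
have V0 q : 0 <= V q by apply: le_trans (vV q h0); apply: normr_ge0.
(* The offset keeps the form of a linear combination with accumulated signs [c]. At [c = 0] and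
   [k = n] the bound is [V q * N]. *)
suff: forall k (c : Q -> R),
  iter k (step (rad D) (signed (fun s h => \sum_q v q h * e q s))) maxv
    (fun h => \sum_q v q h * c q) <= \sum_q V q * (((c q) ^+ 2 + k%:R) / N + N) / 2.
  move=> /(_ n (fun=> 0)); rewrite /Rad.
  under [X in iter _ _ _ X]funext do under eq_bigr do rewrite mulr0.
  under [X in iter _ _ _ X]funext do rewrite big1_eq.
  move=> /le_trans; apply; rewrite big_distrl le_eqVlt; apply/orP; left; apply/eqP.
  apply: eq_bigr => q _; rewrite expr0n /= add0r -NN mulfK ?gt_eqF //.
  by field.
elim => [|k IHk] c.
  apply: maxv_le => h; apply: ler_sum => q _; rewrite addr0.
  apply: (@le_trans _ _ (V q * `|c q|)).
    by rewrite (le_trans (ler_norm _)) // normrM ler_wpM2r.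
  rewrite -mulrA; apply: ler_wpM2l => //.
  rewrite ler_pdivlMr // -(ler_pM2r N0) mulrDl divfK ?gt_eqF //.
  by rewrite -(real_normK (num_real (c q))); have := sqr_ge0 (`|c q| - N); nra.
rewrite iterS step_rad.
under eq_bigr => s _.
  have E b : iter k (step (rad D) (signed (fun s h => \sum_q v q h * e q s))) maxv
    (fun h => \sum_q v q h * c q + b * \sum_q v q h * e q s) =
    iter k (step (rad D) (signed (fun s h => \sum_q v q h * e q s))) maxv
    (fun h => \sum_q v q h * (c q + b * e q s)).
    congr (iter k _ _ _); apply/funext => h; rewrite big_distrr -big_split.
    by apply: eq_bigr => q _ /=; ring.
  have := E 1; have := E (-1).
  under [X in iter _ _ _ X = _]funext do rewrite mulN1r.
  move=> ->; under [X in iter _ _ _ X = _]funext do rewrite mul1r.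
  move=> ->; over.
rewrite -[leRHS]mul1r -[X in _ <= X * _]D1 big_distrl; apply: ler_sum => s _; apply: ler_wpM2l => //.
have := IHk (fun q => c q + 1 * e q s); have := IHk (fun q => c q + -1 * e q s).
move=> A B; rewrite ler_pdivrMr //. apply: le_trans (lerD B A) _.
rewrite -big_split big_distrl; apply: ler_sum => q _ /=.
rewrite -[leLHS]mulrDl -mulrDr -!mulrA; apply: ler_wpM2l => //.
(* The cross terms of [(c + e) ^ 2] and [(c - e) ^ 2] cancel, and [e ^ 2 <= 1] pays for the passage
   from [k] to [k + 1]. *)
have e2 : (e q s) ^+ 2 <= 1 by rewrite -real_normK ?num_real // expr_le1.
rewrite mulVf // mulr1 -natr1 ler_pdivrMr //.
have I0 : 0 <= N^-1 by rewrite invr_ge0 ltW.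
have := mulr_ge0 I0 (_ : 0 <= 2 - 2 * (e q s) ^+ 2); rewrite subr_ge0 -[X in _ <= X]mulr1 ler_pM2l //.
by move=> /(_ e2); nra.
Qed.

(** From [expR (- x) >= 1 - x] one gets [expR x * (1 - x) <= 1], while [(1 - x) * (1 + x + 2 x ^ 2)
    = 1 + x ^ 2 * (1 - 2 x) >= 1]. *)
Lemma expR_le_quad (x : R) : `|x| <= 2^-1 -> expR x <= 1 + x + 2 * x ^+ 2.
Proof.
rewrite ler_norml => /andP[x1 x2].
have := expR_ge1Dx (- x); have := expRN x; have := expR_gt0 x => X0 XN X1.
have : expR x * (1 - x) <= 1.
  by apply: le_trans (ler_wpM2l (ltW X0) X1) _; rewrite XN mulfV ?gt_eqF.
nra.
Qed.

(** The maximum is bounded by the logarithm of a sum of exponentials. The scale [la] keeps the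
    exponents of one sample below [1 / (2 N)], so a centred sample multiplies the mean exponential
    by at most [1 + 1 / (2 n) <= M]. *)
Lemma Ex_maxv_finite T (D : T -> R) (G : T -> H -> R) (K : R) n :
  (forall s, 0 <= D s) -> \sum_s D s = 1 -> (0 < n)%N -> 0 < K ->
  (forall h, \sum_s D s * G s h = 0) -> (forall s h, `|G s h| <= K) ->
  Ex D (fun S : n.-tuple T => maxv (fun h => \sum_(i < n) G (tnth S i) h)) <=
  2 * K * Num.sqrt n%:R * (ln #|H|%:R + 1).
Proof.
move=> D0 D1 n0 K0 G0 GK; set N : R := Num.sqrt n%:R.
have N0 : 0 < N by rewrite sqrtr_gt0 ltr0n.
have NN : N * N = n%:R by rewrite -expr2 sqr_sqrtr.
have N1 : 1 <= N by rewrite -sqrtr1 ler_wsqrtr // ler1n.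
have H0 : 0 < #|H|%:R :> R by rewrite ltr0n; apply/card_gt0P; exists h0.
pose la : R := (2 * K * N)^-1.
have la0 : 0 < la by rewrite invr_gt0 !mulr_gt0.
have laK : la * K = (2 * N)^-1 by rewrite /la; field; rewrite !gt_eqF.
pose M : R := expR (n%:R^-1).
pose Z : R := #|H|%:R * expR 1.
have Z0 : 0 < Z by rewrite mulr_gt0 ?expR_gt0.
have -> : Ex D (fun S : n.-tuple T => maxv (fun h => \sum_(i < n) G (tnth S i) h))
    = iter n (step D G) maxv (fun=> 0).
  by rewrite -Ex_iter; apply: eq_Ex => S; congr maxv; apply/funext => h; rewrite add0r.
(* The logarithm is replaced by its tangent at [Z], which is affine and so commutes with averaging.
   [Z] is the value of the sum of exponentials times [M ^ n] at offset 0, where the tangent is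
   exact. *)
suff: forall k a, iter k (step D G) maxv a <=
    la^-1 * ((\sum_h expR (la * a h)) * M ^+ k / Z - 1 + ln Z).
  move=> /(_ n (fun=> 0)) /le_trans; apply; rewrite /la invrK; apply: ler_wpM2l.
    by rewrite !mulr_ge0 // ltW.
  under eq_bigr do rewrite mulr0 expR0.
  rewrite sumr_const -/(_%:R) cardT -cardE /M -expRM_natl mulfV ?pnatr_eq0 -?lt0n //.
  by rewrite mulfV ?gt_eqF // subrr add0r /Z lnM ?posrE ?expR_gt0 // expRK.
elim => [|k IHk] a.
  rewrite /=; have [h ->] := maxv_ex a; rewrite expr0 mulr1 -(ler_pM2l la0) mulrA mulfV ?gt_eqF // mul1r.
  have le1 : expR (la * a h) <= \sum_h expR (la * a h).
    by rewrite (bigD1 h) //= lerDl sumr_ge0 // => i _; rewrite expR_ge0.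
  set X := \sum_h _ in le1 *.
  have X0 : 0 < X by apply: lt_le_trans le1; apply: expR_gt0.
  have := le_ln1Dx (x := X / Z - 1); rewrite (addrC 1) subrK.
  have -> : -1 < X / Z - 1 by rewrite ltrBrDr addNr divr_gt0.
  move=> /(_ isT); rewrite ln_div ?posrE // => le2.
  have : la * a h <= ln X by rewrite -[leLHS]expRK ler_ln ?posrE ?expR_gt0.
  lra.
rewrite iterS /step.
apply: (@le_trans _ _ (\sum_s D s * (la^-1 * ((\sum_h expR (la * (a h + G s h))) * M ^+ k / Z - 1 + ln Z)))).
  by apply: ler_sum => s _; apply: ler_wpM2l.
have -> : \sum_s D s * (la^-1 * ((\sum_h expR (la * (a h + G s h))) * M ^+ k / Z - 1 + ln Z)) =
  la^-1 * ((\sum_s D s * \sum_h expR (la * (a h + G s h))) * M ^+ k / Z - 1 + ln Z).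
  rewrite -[X in _ = _ * (_ - X + _)]D1 -[X in _ = _ * (_ + X)]mul1r -[X in _ = _ * (_ + X * _)]D1.
  rewrite !big_distrl -sumrB -big_split big_distrr; apply: eq_bigr => s _ /=; ring.
apply: ler_wpM2l; first by rewrite invr_ge0 ltW.
rewrite !lerD2r exprS mulrA; apply: ler_wpM2r; first by rewrite invr_ge0 ltW.
apply: ler_wpM2r; first by rewrite exprn_ge0 // expR_ge0.
under eq_bigr do rewrite big_distrr /=.
rewrite exchange_big big_distrl; apply: ler_sum => h _.
under eq_bigr do rewrite mulrDr expRD mulrCA.
rewrite -big_distrr; apply: ler_wpM2l; first exact: expR_ge0.
have lG s : `|la * G s h| <= (2 * N)^-1.
  by rewrite normrM gtr0_norm // -laK ler_wpM2l // ltW.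
apply: (@le_trans _ _ (\sum_s D s * (1 + la * G s h + 2 * ((2 * N)^-1) ^+ 2))).
  apply: ler_sum => s _; apply: ler_wpM2l => //.
  apply: le_trans (expR_le_quad _) _.
    by apply: le_trans (lG s) _; rewrite lef_pV2 ?posrE ?mulr_gt0 // ler_peMr.
  rewrite lerD2l ler_pM2l // -real_normK ?num_real // lerXn2r ?nnegrE //.
  by rewrite invr_ge0 mulr_ge0 // ltW.
under eq_bigr do rewrite !mulrDr mulr1 mulrCA.
rewrite !big_split /= -big_distrr /= G0 mulr0 addr0 -big_distrl /= D1 mul1r.
apply: le_trans (expR_ge1Dx _); rewrite lerD2l exprVn exprMn [N ^+ 2]expr2 NN.
rewrite invfM mulrA; apply: ler_piMl; first by rewrite invr_ge0 ler0n.
lra.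
Qed.

End Sup.
End EmpiricalProcess.

(** * Randomized response followed by the exponential mechanism *)

Section Gibbs.
Variables (R : realType) (H : finType).
Implicit Types (sc : H -> R) (la : R).

Definition gibbs la sc (h : H) : R :=
  expR (- la * sc h) / \sum_g expR (- la * sc g).

Lemma gibbs_den_gt0 la sc (h0 : H) : 0 < \sum_g expR (- la * sc g).
Proof.
rewrite (bigD1 h0) //=; apply: ltr_wpDr (expR_gt0 _).
by apply: sumr_ge0 => g _; apply: expR_ge0.
Qed.

Lemma gibbs_gt0 la sc h : 0 < gibbs la sc h.
Proof. by rewrite divr_gt0 ?expR_gt0 // (gibbs_den_gt0 _ _ h). Qed.

Lemma gibbs_sum la sc (h0 : H) : \sum_h gibbs la sc h = 1.
Proof. by rewrite -big_distrl /= mulfV // gt_eqF // (gibbs_den_gt0 _ _ h0). Qed.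

(** The weight of [h] and the normalizing sum each contribute a factor [expR (la * r)]. *)
Lemma gibbs_stable la sc sc' (r : R) h : 0 <= la ->
  (forall g, `|sc g - sc' g| <= r) -> gibbs la sc h <= expR (2 * la * r) * gibbs la sc' h.
Proof.
move=> la0 scr.
have le g (s s' : H -> R) : (forall g, `|s g - s' g| <= r) ->
    expR (- la * s g) <= expR (la * r) * expR (- la * s' g).
  move=> /(_ g); rewrite -expRD ler_expR ler_norml => /andP[A B].
  have := ler_wpM2l la0 A; lra.
have scr' g : `|sc' g - sc g| <= r by rewrite distrC.
have Z := gibbs_den_gt0 la sc h; have Z' := gibbs_den_gt0 la sc' h.
rewrite /gibbs mulrA ler_pdivrMr // mulrAC ler_pdivlMr //.
have -> : expR (2 * la * r) = expR (la * r) * expR (la * r) by rewrite -expRD; congr expR; ring.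
have A := le h _ _ scr.
have B : \sum_g expR (- la * sc' g) <= expR (la * r) * \sum_g expR (- la * sc g).
  by rewrite big_distrr; apply: ler_sum => g _; apply: le.
apply: le_trans (ler_pM (expR_ge0 _) (ltW Z') A B) _.
by rewrite le_eqVlt; apply/orP; left; apply/eqP; ring.
Qed.

(* Gibbs' variational principle; the entropy is at most ln #|H| since ln x <= x - 1. *)
Lemma gibbs_utility la sc h : 0 < la ->
  \sum_g gibbs la sc g * sc g <= sc h + ln #|H|%:R / la.
Proof.
move=> la0; set Z := \sum_g expR (- la * sc g).
have Z0 : 0 < Z := gibbs_den_gt0 la sc h.
have H0 : 0 < #|H|%:R :> R by rewrite ltr0n; apply/card_gt0P; exists h.
have key g : gibbs la sc g * sc g <=
    la^-1 * (#|H|%:R^-1 - gibbs la sc g + gibbs la sc g * (ln #|H|%:R - ln Z)).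
  set p := gibbs la sc g; have p0 : 0 < p := gibbs_gt0 la sc g.
  have lnp : ln p = - la * sc g - ln Z by rewrite /p /gibbs ln_div ?posrE ?expR_gt0 // expRK.
  have pH : 0 < p * #|H|%:R by rewrite mulr_gt0.
  have := le_ln1Dx (x := (p * #|H|%:R)^-1 - 1); rewrite (addrC 1) subrK.
  have -> : -1 < (p * #|H|%:R)^-1 - 1 by rewrite ltrBrDr addNr invr_gt0.
  move=> /(_ isT); rewrite lnV ?posrE // lnM ?posrE // lnp.
  move=> /(ler_wpM2l (ltW p0)); rewrite mulrBr mulr1 invfM mulrA mulfV ?gt_eqF // mul1r => le1.
  rewrite -(ler_pM2l la0) [leRHS]mulrA mulfV ?gt_eqF // mul1r; lra.
apply: le_trans (ler_sum _ (fun g _ => key g)) _.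
rewrite -big_distrr big_split sumrB /= -[X in _ * (_ + X)]big_distrl /= (gibbs_sum _ _ h) sumr_const.
rewrite -[_ *+ _]mulr_natl mulfV ?gt_eqF // subrr add0r mul1r.
have : - la * sc h <= ln Z.
  rewrite -[leLHS]expRK ler_ln ?posrE ?expR_gt0 // /Z (bigD1 h) //= lerDl.
  by apply: sumr_ge0 => g _; apply: expR_ge0.
move=> le2; rewrite -(ler_pM2l la0) [leLHS]mulrA mulfV ?gt_eqF // mul1r mulrDr mulrCA mulfV ?gt_eqF //.
lra.
Qed.
End Gibbs.

(** * Privacy and utility of the mechanism *)

Section Mechanism.
Variables (R : realType) (d : nat) (eta : R).
Implicit Types (D : record d -> R).

Lemma sum_pair (I J : finType) (F : I * J -> R) : \sum_s F s = \sum_x \sum_y F (x, y).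
Proof. by rewrite (pair_bigA _ (fun x y => F (x, y))); apply: eq_bigr => -[]. Qed.

Definition rr (y b : bool) : R := (if b == y then 1 + eta else 1 - eta) / 2.

Definition noisy D (s : record d) : R := \sum_y rr y s.2 * D (s.1, y).

Definition relabel n (S : n.-tuple (record d)) (b : n.-tuple bool) : n.-tuple (record d) :=
  [tuple ((tnth S i).1, tnth b i) | i < n].

Lemma relabel_cons n s (S : n.-tuple (record d)) c (b : n.-tuple bool) :
  relabel (cons_tuple s S) (cons_tuple c b) = cons_tuple (s.1, c) (relabel S b).
Proof.
apply: eq_from_tnth => i; rewrite tnth_mktuple.
case: (unliftP ord0 i) => [j ->|->]; last by rewrite !tnth0.
by rewrite !tnthS tnth_mktuple.
Qed.

(** The labels are randomized independently, so the relabelled sample is again independent, with law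
    [noisy D]. *)
Lemma Ex_relabel n D (F : n.-tuple (record d) -> R) :
  Ex D (fun S => \sum_b (\prod_(i < n) rr (tnth S i).2 (tnth b i)) * F (relabel S b)) =
  Ex (noisy D) F.
Proof.
elim: n F => [|n IHn] F.
  rewrite !Ex_nil (bigD1 [tuple]) //= big_ord0 mul1r big1 ?addr0 => [|b /eqP[]]; last exact: tuple0.
  by congr F; apply: tuple0.
rewrite !Ex_cons.
have E s : Ex D (fun S : n.-tuple (record d) => \sum_b (\prod_(i < n.+1)
    rr (tnth (cons_tuple s S) i).2 (tnth b i)) * F (relabel (cons_tuple s S) b)) =
    \sum_c rr s.2 c * Ex (noisy D) (fun S => F (cons_tuple (s.1, c) S)).
  under [RHS]eq_bigr => c _ do rewrite -IHn -ExZ.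
  rewrite [in RHS]/Ex exchange_big; apply: eq_bigr => S _ /=; rewrite -big_distrr /=.
  congr (_ * _); rewrite sum_tuple_cons; apply: eq_bigr => c _.
  rewrite big_distrr; apply: eq_bigr => b _ /=.
  rewrite big_ord_recl !tnth0 relabel_cons mulrA.
  by congr (_ * _ * _); apply: eq_bigr => i _; rewrite !tnthS.
under eq_bigr do rewrite E.
rewrite !sum_pair; apply: eq_bigr => x _; under eq_bigr do rewrite big_distrr.
rewrite exchange_big; apply: eq_bigr => c _ /=; rewrite [in RHS]/noisy big_distrl /=.
by apply: eq_bigr => y _; rewrite mulrCA mulrA.
Qed.

Hypotheses (eta0 : 0 < eta) (eta1 : eta < 1).

Lemma rr_gt0 y b : 0 < rr y b.
Proof. by move: eta0 eta1 => e0 e1; rewrite /rr; case: eqP => _; lra. Qed.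

Lemma rr_sum y : \sum_b rr y b = 1.
Proof. by rewrite big_bool /rr; case: y => /=; lra. Qed.

Lemma noisy_ge0 D : (forall s, 0 <= D s) -> forall s, 0 <= noisy D s.
Proof. by move=> D0 s; apply: sumr_ge0 => y _; rewrite mulr_ge0 // ltW // rr_gt0. Qed.

(* The expectation of [debias l] under randomized response of the label is [l]. *)
Definition debias (l : cube d -> bool -> R) (s : record d) : R :=
  ((1 + eta) * l s.1 s.2 - (1 - eta) * l s.1 (~~ s.2)) / (2 * eta).

Lemma noisy_debias D l :
  \sum_s noisy D s * debias l s = \sum_s D s * l s.1 s.2.
Proof.
rewrite !sum_pair; apply: eq_bigr => x _; rewrite !big_bool /noisy !big_bool /debias /rr /=.
by field; rewrite gt_eqF.
Qed.

Lemma noisy_sum D : \sum_s noisy D s = \sum_s D s.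
Proof.
rewrite !sum_pair; by apply: eq_bigr => x _; rewrite !big_bool /noisy !big_bool /rr /=; field.
Qed.

(** The absolute values of the two coefficients in [debias] add up to [1 / eta]. *)
Lemma debias_lip (l : cube d -> bool -> R) x x' b (r : R) :
  (forall y, `|l x y - l x' y| <= r) -> `|debias l (x, b) - debias l (x', b)| <= r / eta.
Proof.
move: (eta0) (eta1) => e0 e1 lr; rewrite /debias /= -mulrBl normrM (ger0_norm (_ : 0 <= (2 * eta)^-1)); last by rewrite invr_ge0; lra.
rewrite ler_pdivrMr; last by lra.
have -> : r / eta * (2 * eta) = (1 + eta) * r + (1 - eta) * r by field; rewrite gt_eqF.
have := lr b; have := lr (~~ b); rewrite !ler_norml => /andP[A B] /andP[A' B'].
have p1 : 0 <= 1 + eta by lra.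
have p2 : 0 <= 1 - eta by lra.
have := ler_wpM2l p1 A'; have := ler_wpM2l p1 B'.
have := ler_wpM2l p2 A; have := ler_wpM2l p2 B.
by move=> ? ? ? ?; apply/andP; split; lra.
Qed.

Variables (H : finType) (h0 : H) (n : nat) (la : R) (hy : H -> hyp d)
  (l : H -> cube d -> bool -> R).
Hypothesis la0 : 0 < la.

Definition score (S : n.-tuple (record d)) (h : H) : R :=
  \sum_(i < n) debias (l h) (tnth S i).

(** The Gibbs law lives on an index type [H] and is pushed forward by [hy], since distinct indices
    may give the same hypothesis. *)
Definition rr_gibbs : mechanism R d n := fun S => [ffun g =>
  \sum_b (\prod_(i < n) rr (tnth S i).2 (tnth b i)) *
    \sum_(h | hy h == g) gibbs la (score (relabel S b)) h].

Lemma rr_gibbs_int (S : n.-tuple (record d)) (f : hyp d -> R) :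
  \sum_g rr_gibbs S g * f g = \sum_b (\prod_(i < n) rr (tnth S i).2 (tnth b i)) *
    \sum_h gibbs la (score (relabel S b)) h * f (hy h).
Proof.
under eq_bigr do rewrite ffunE big_distrl /=.
rewrite exchange_big; apply: eq_bigr => b _ /=.
under eq_bigr do rewrite -mulrA.
rewrite -big_distrr /=; congr (_ * _).
rewrite [RHS](partition_big hy predT) //=; apply: eq_bigr => g _.
by rewrite big_distrl; apply: eq_bigr => h /eqP <-.
Qed.

Lemma rr_prod_sum (S : n.-tuple (record d)) :
  \sum_(b : n.-tuple bool) \prod_(i < n) rr (tnth S i).2 (tnth b i) = 1.
Proof.
elim: n S => [|m IHm] S.
  rewrite (bigD1 [tuple]) //= big_ord0 big1 ?addr0 // => b /eqP[]; exact: tuple0.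
case/tupleP: S => s S; rewrite sum_tuple_cons -[RHS](rr_sum s.2).
apply: eq_bigr => c _; rewrite -[RHS]mulr1 -[X in _ = _ * X](IHm S) big_distrr; apply: eq_bigr => b _ /=.
rewrite big_ord_recl !tnth0; congr (_ * _); apply: eq_bigr => i _.
by rewrite !tnthS.
Qed.

Lemma rr_gibbs_valid : (forall h, is_halfspace R (hy h)) -> valid_halfspace_mech rr_gibbs.
Proof.
move=> hyH S; split; last first.
  move=> g; rewrite ffunE => /eqP N0; apply: contrapT => gN; apply: N0.
  apply: big1 => b _; rewrite [X in _ * X]big1 ?mulr0 // => h /eqP hg; case: gN; rewrite -hg; exact: hyH.
split=> [g|].
  rewrite ffunE; apply: sumr_ge0 => b _; apply: mulr_ge0.
    by apply: prodr_ge0 => i _; rewrite ltW // rr_gt0.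
  by apply: sumr_ge0 => h _; rewrite ltW // gibbs_gt0.
transitivity (\sum_g rr_gibbs S g * 1); first by apply: eq_bigr => g _; rewrite mulr1.
rewrite (rr_gibbs_int S (fun=> 1)) -[RHS](rr_prod_sum S); apply: eq_bigr => b _.
by rewrite -big_distrl /= (gibbs_sum _ _ h0) !mulr1.
Qed.

(** For fixed noisy labels [b], the true labels enter only the response probabilities and the points
    only the Gibbs weights. The two ratios are bounded separately, by the label part and by the
    Hamming part of [rec_dist]. *)
Lemma rr_gibbs_DP eps (B : R) : 0 <= B -> (1 + eta) <= expR eps * (1 - eta) -> 0 < eps ->
  2 * la * (B / eta) <= eps ->
  (forall h x x' y, `|l h x y - l h x' y| <= B * (hamming x x')%:R) ->
  nabla0_DP eps rr_gibbs.
Proof.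
move: (eta0) (eta1) => e0 e1 B0 rre eps0 laB lip S S' i SS' E.
rewrite /prob_in big_distrr; apply: ler_sum => g _ /=.
rewrite !ffunE big_distrr; apply: ler_sum => b _ /=.
rewrite /rec_dist natrD mulrDr expRD.
have -> : forall a b c e : R, a * b * (c * e) = (b * c) * (a * e) by move=> *; ring.
apply: ler_pM.
- by apply: prodr_ge0 => j _; rewrite ltW // rr_gt0.
- by apply: sumr_ge0 => h _; rewrite ltW // gibbs_gt0.
- rewrite (bigD1 i) //= [X in _ <= _ * X](bigD1 i) //= mulrA.
  rewrite (eq_bigr (fun j => rr (tnth S' j).2 (tnth b j))); last by move=> j /SS' ->.
  apply: ler_wpM2r; first by apply: prodr_ge0 => j _; rewrite ltW // rr_gt0.
  have E1 : 1 <= expR eps by rewrite -expR0 ler_expR ltW.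
  have E2 : 1 - eta <= expR eps * (1 + eta).
    by apply: le_trans (_ : 1 * (1 + eta) <= _); [lra|apply: ler_wpM2r => //; lra].
  rewrite /rr; case: (tnth S i).2; case: (tnth S' i).2; case: (tnth b i) => /=;
    rewrite ?mulr0 ?mulr1 ?expR0 ?mul1r //; lra.
rewrite big_distrr; apply: ler_sum => h _ /=.
apply: le_trans (gibbs_stable (sc' := score (relabel S' b)) (r := B * (hamming (tnth S i).1 (tnth S' i).1)%:R / eta) h (ltW la0) _) _.
  move=> k; rewrite /score (bigD1 i) //= [X in `|_ - X|](bigD1 i) //=.
  rewrite (eq_bigr (fun j => debias (l k) (tnth (relabel S' b) j))); last first.
    by move=> j /SS' E1; rewrite !tnth_mktuple E1.
  rewrite opprD addrACA subrr addr0 !tnth_mktuple; apply: debias_lip => y; exact: lip.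
apply: ler_wpM2r; first by rewrite ltW // gibbs_gt0.
rewrite ler_expR; have := ler_wpM2r (ler0n R (hamming (tnth S i).1 (tnth S' i).1)) laB.
by apply: le_trans; rewrite le_eqVlt; apply/orP; left; apply/eqP; ring.
Qed.

(** The robust error of [g] is at most its mean debiased loss, that is [1 / n] times its score plus
    a deviation bounded by the supremum. Gibbs' principle compares the mean score with that of [h];
    as [h] is fixed, its score is unbiased. *)
Lemma rr_gibbs_utility (D : {ffun record d -> R}) gamma' h : (0 < n)%N -> is_pmf D ->
  (forall g r, (if [exists xc : cube d, (hy g xc != r.2) && ((hamming xc r.1)%:R <= gamma' * d%:R)]
     then 1 else 0) <= l g r.1 r.2) ->
  expected_robust_err rr_gibbs gamma' D <= \sum_r D r * l h r.1 r.2 +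
    (Ex (noisy D) (fun S : n.-tuple (record d) => maxv h0 (fun g => \sum_(i < n)
       (\sum_t noisy D t * debias (l g) t - debias (l g) (tnth S i))))
     + ln #|H|%:R / la) / n%:R.
Proof.
move=> n0 [D0 D1] ll.
have N0 : 0 < n%:R :> R by rewrite ltr0n.
have nD0 := noisy_ge0 D0; have nD1 : \sum_s noisy D s = 1 by rewrite noisy_sum.
rewrite /expected_robust_err.
under eq_bigr do rewrite (rr_gibbs_int _ (fun g => robust_err gamma' g D)).
rewrite -/(Ex D (fun S => \sum_b _)).
rewrite (Ex_relabel D (fun S => \sum_h gibbs la (score S) h * robust_err gamma' (hy h) D)).
pose L g := \sum_t noisy D t * debias (l g) t.
pose X S := maxv h0 (fun g => \sum_(i < n) (L g - debias (l g) (tnth S i))).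
apply: (@le_trans _ _ (Ex (noisy D) (fun S => n%:R^-1 * (score S h + (X S + ln #|H|%:R / la))))).
  apply: ler_Ex => // S; rewrite -(ler_pM2l N0) [leRHS]mulrA mulfV ?gt_eqF // mul1r.
  apply: (@le_trans _ _ (\sum_g gibbs la (score S) g * (score S g + X S))).
    rewrite big_distrr; apply: ler_sum => g _ /=; rewrite mulrCA; apply: ler_wpM2l.
      by rewrite ltW // gibbs_gt0.
    apply: (@le_trans _ _ (n%:R * L g)).
      rewrite ler_pM2l // /L noisy_debias; apply: ler_sum => r _; exact: ler_wpM2l.
    have := maxv_ge h0 (fun g => \sum_(i < n) (L g - debias (l g) (tnth S i))) g.
    rewrite -/(X S) sumrB sumr_const card_ord -/(score S g) -mulr_natl; lra.
  under eq_bigr do rewrite mulrDr.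
  rewrite big_split -big_distrl /= (gibbs_sum _ _ h0) mul1r addrCA addrC lerD2l addrC.
  by apply: le_trans (gibbs_utility _ h la0) _; rewrite addrC.
rewrite ExZ !ExD Ex_cst // Ex_sum // noisy_debias.
rewrite mulrDr mulrA mulVf ?gt_eqF // mul1r lerD2l mulrC.
by [].
Qed.

End Mechanism.

(** * Truncated weights on the cube *)

Section Cube.
Variables (R : realType) (d : nat).
Implicit Types (z x : cube d) (B : {set 'I_d}).

Definition flip B z : cube d := [ffun j => (j \in B) (+) z j].

Lemma hamming_flip B z : hamming (flip B z) z = #|B|.
Proof.
by apply: eq_card => j; rewrite inE ffunE; case: (j \in B); case: (z j).
Qed.

Lemma hammingC z x : hamming z x = hamming x z.
Proof. by apply: eq_card => j; rewrite !inE eq_sym. Qed.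

Lemma hamming_triangle x z t : (hamming x t <= hamming x z + hamming z t)%N.
Proof.
apply: leq_trans (leq_card_setU _ _); apply: subset_leq_card.
apply/fintype.subsetP => j; rewrite !inE; by case: (x j); case: (z j); case: (t j).
Qed.

(** The point times its label, which reduces both labels to the label [true]. *)
Definition signflip (y : bool) x : cube d := [ffun j => x j == y].

Lemma signflipK y : involutive (signflip y).
Proof. by move=> x; apply/ffunP => j; rewrite !ffunE; case: y; case: (x j). Qed.

Lemma hamming_signflip y x z : hamming (signflip y x) (signflip y z) = hamming x z.
Proof. by apply: eq_card => j; rewrite !inE !ffunE; case: y; case: (x j); case: (z j). Qed.

Lemma sgnvalE (b c : bool) : sgnval (b == c) = sgnval b * sgnval c :> R.
Proof. by case: b; case: c; rewrite /= ?mulr1 ?mulrNN ?mul1r ?mulN1r. Qed.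

Lemma inner_signflip (w : 'I_d -> R) y x : inner w (signflip y x) = sgnval y * inner w x.
Proof.
rewrite /inner big_distrr; apply: eq_bigr => j _ /=.
by rewrite ffunE sgnvalE; ring.
Qed.

Lemma exists_topset (v : 'I_d -> R) q : (0 < d)%N -> (q <= d)%N ->
  exists (T : {set 'I_d}) t, [/\ #|T| = q, forall i, i \in T -> t <= v i
                           & forall j, j \notin T -> v j <= t].
Proof.
move=> d0; elim: q => [|q IHq] qd.
  case: d v d0 => // d' v _; exists finset.set0, (v [arg max_(i > ord0) v i]%O); split.
  - by rewrite cards0.
  - by move=> i; rewrite inE.
  - by move=> j _; case: arg_maxP => // i _; apply.
have [T [t [Tq tT Tt]]] := IHq (ltnW qd).
have [i0 i0T] : exists i, i \in ~: T.
  by apply/set0Pn; rewrite -card_gt0 cardsCs finset.setCK card_ord Tq subn_gt0.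
rewrite inE in i0T; case: (@arg_maxP _ _ _ _ (fun i => i \notin T) v i0T) => i iT imax.
exists (i |: T), (v i); split.
- by rewrite cardsU1 iT Tq.
- by move=> j; rewrite in_setU1 => /orP[/eqP -> //|jT]; apply: le_trans (Tt _ iT) (tT _ jT).
- by move=> j; rewrite in_setU1 negb_or => /andP[_ jT]; exact: imax.
Qed.

(** The average over [T] is at least [t] and the average over the complement at most [t]. *)
Lemma topset_avg (v : 'I_d -> R) (T : {set 'I_d}) t :
  (forall i, i \in T -> t <= v i) -> (forall j, j \notin T -> v j <= t) ->
  #|T|%:R * \sum_j v j <= d%:R * \sum_(j in T) v j.
Proof.
move=> tT Tt.
have A : #|T|%:R * t <= \sum_(j in T) v j.
  by rewrite mulr_natl -sumr_const; apply: ler_sum => j; apply: tT.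
have E : d%:R = #|T|%:R + #|~: T|%:R :> R by rewrite -natrD cardsC card_ord.
have B : \sum_(j in ~: T) v j <= #|~: T|%:R * t.
  by rewrite mulr_natl -sumr_const; apply: ler_sum => j; rewrite inE; apply: Tt.
have -> : \sum_j v j = \sum_(j in T) v j + \sum_(j in ~: T) v j.
  rewrite (bigID (mem T)) /=; congr (_ + _); apply: eq_bigl => j; by rewrite inE.
rewrite E; have := ler_wpM2l (ler0n R #|~: T|) A; have := ler_wpM2l (ler0n R #|T|) B.
lra.
Qed.

Lemma sgnval_contra (b : bool) : sgnval (~~ b) = - sgnval b :> R.
Proof. by case: b; rewrite /= ?opprK. Qed.

(* Flipping the coordinates of T that help, the truncation at t only increases
   the margin; a further robustness to q flips forces that margin up to q^2 t / d. *)
Lemma truncated_margin (w : 'I_d -> R) (T B : {set 'I_d}) (t : R) (K k q : nat) z :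
  (0 < d)%N -> (q <= d)%N -> (k + 2 * q <= K)%N ->
  #|T| = q -> 0 <= t -> (forall j, j \in T -> t <= `|w j|) -> (forall j, j \notin T -> `|w j| <= t) ->
  (#|B| <= k)%N ->
  (forall z', (hamming z' z <= K)%N -> 0 <= inner w z') ->
  q%:R ^+ 2 * t <= d%:R * inner (fun j => Num.sg (w j) * Num.min `|w j| t) (flip B z).
Proof.
move=> d0 qd kqK Tq t0 tT Tt Bk rob.
set z1 := flip B z; set z2 := flip (T :&: [set j | 0 < w j * sgnval (z1 j)]) z1.
have h1 : (hamming z1 z <= k)%N by rewrite hamming_flip.
have h2 : (hamming z2 z <= k + q)%N.
  apply: leq_trans (hamming_triangle _ z1 _) _; rewrite addnC leq_add // hamming_flip.
  by rewrite -Tq subset_leq_card // subsetIl.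
(* On [T] every term of [w] at [z2] is minus the absolute weight, hence at most [- t], and no
   truncated term is below [- t]. Off [T] the two sides agree. *)
have X2 : inner w z2 <= inner (fun j => Num.sg (w j) * Num.min `|w j| t) z1.
  apply: ler_sum => j _; rewrite /z2 ffunE !inE.
  case: (boolP (j \in T)) => jT /=; last first.
    by rewrite min_l ?Tt // -numEsg.
  rewrite min_r ?tT //; have := tT j jT.
  case: (z1 j) => /=; rewrite ?mulr1 ?mulrN1 ?oppr_gt0;
    case: (ltrgtP (w j) 0) => wj /=;
    rewrite ?(gtr0_sg wj) ?(ltr0_sg wj) ?(gtr0_norm wj) ?(ltr0_norm wj) ?wj ?sgr0 ?normr0; lra.
(* Flipping the [q] largest positive terms lowers the margin by twice their sum, at least [2 q / d]
   times the sum of all [v]. The margin stays nonnegative, and twice the sum of [v] is at least the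
   l1 norm of [w], so at least [q * t]. *)
pose v j := Num.max 0 (w j * sgnval (z2 j)).
have v0 j : 0 <= v j by rewrite le_max lexx.
have [A [s [Aq sA As]]] := exists_topset v d0 qd.
set z3 := flip (A :&: [set j | 0 < w j * sgnval (z2 j)]) z2.
have h3 : (hamming z3 z <= K)%N.
  apply: leq_trans kqK; apply: leq_trans (hamming_triangle _ z2 _) _.
  rewrite mul2n -addnn addnA addnC leq_add // hamming_flip.
  by rewrite -Aq subset_leq_card // subsetIl.
have E3 : inner w z3 = inner w z2 - 2 * \sum_(j in A) v j.
  rewrite big_mkcond big_distrr -sumrB; apply: eq_bigr => j _ /=.
  rewrite /z3 ffunE !inE /v; case: (j \in A) => /=; last by rewrite mulr0 subr0.
  case: ltP => wz /=; last by rewrite mulr0 subr0.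
  by rewrite sgnval_contra; ring.
have := rob z3 h3; rewrite E3 subr_ge0 => r3.
have r2 : 0 <= inner w z2.
  apply: rob; apply: leq_trans h2 (leq_trans _ kqK).
  by rewrite leq_add2l mul2n -addnn leq_addr.
have Sv : q%:R * t <= 2 * \sum_j v j.
  apply: (@le_trans _ _ (\sum_(j in T) `|w j|)).
    by rewrite -Tq mulr_natl -sumr_const; apply: ler_sum => j; apply: tT.
  apply: (@le_trans _ _ (\sum_j `|w j|)).
    by rewrite [leRHS](bigID (mem T)) /= lerDl sumr_ge0.
  have : \sum_j `|w j| = 2 * \sum_j v j - inner w z2.
    rewrite /inner big_distrr -sumrB; apply: eq_bigr => j _ /=; rewrite /v.
    case: (z2 j) => /=; rewrite ?mulr1 ?mulrN1; case: leP => wj.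
    - by rewrite ger0_norm //; lra.
    - by rewrite ltr0_norm //; lra.
    - by rewrite ler0_norm; lra.
    - by rewrite gtr0_norm; lra.
  lra.
have := topset_avg sA As; rewrite Aq => avg.
have := ler_wpM2l (ler0n R d) X2; have := ler_wpM2l (ler0n R d) r3.
have := ler_wpM2l (ler0n R q) Sv; rewrite expr2 => ? ? ?; lra.
Qed.

(** Flipping all positive terms, which lie in [T], turns the margin into minus the l1 norm of
    [w]. *)
Lemma not_robust (w : 'I_d -> R) (T : {set 'I_d}) K z :
  (#|T| <= K)%N -> (forall j, j \notin T -> w j = 0) -> (exists j, w j != 0) ->
  (forall z', (hamming z' z <= K)%N -> 0 <= inner w z') -> False.
Proof.
move=> TK Tw [i wi] /(_ (flip (T :&: [set j | 0 < w j * sgnval (z j)]) z)).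
rewrite hamming_flip => /(_ _)/wrap[].
  by apply: leq_trans TK; rewrite subset_leq_card // subsetIl.
apply/negP; rewrite -ltNge.
apply: (@le_lt_trans _ _ (- \sum_j `|w j|)).
  rewrite -sumrN; apply: ler_sum => j _; rewrite ffunE !inE.
  case: (boolP (j \in T)) => jT /=; last by rewrite Tw // mul0r normr0 oppr0.
  case: (z j) => /=; rewrite ?mulr1 ?mulrN1 ?oppr_gt0; case: (ltrgtP (w j) 0) => wj /=;
    rewrite ?(gtr0_norm wj) ?(ltr0_norm wj) ?wj ?normr0; lra.
rewrite oppr_lt0 (bigD1 i) //=; apply: ltr_wpDr; last by rewrite normr_gt0.
exact: sumr_ge0.
Qed.

End Cube.

(** * Integer weights *)

Section IntegerWeights.
Variables (R : realType) (d m k : nat) (Mg : R).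

(* The weight of coordinate j is a (j, true) - a (j, false); a (j, b) bounds the loss
   of margin when a coordinate of sign b is flipped. *)
Definition weights := {ffun 'I_d * bool -> 'I_m.+1}.
Implicit Types (h : option weights) (x z : cube d) (y b : bool).

Definition wval h (q : 'I_d * bool) : nat := if h is Some a then a q else 0%N.
Arguments wval : simpl never.

Definition whyp h : hyp d :=
  halfspace (fun j => (wval h (j, true))%:R - (wval h (j, false))%:R : R).

(** Level sets: the sum over [l < m] of the sizes capped at [k] is the sum of the [k] largest values
    [wval h (j, z j)]. *)
Definition wlayer h z (l : nat) : {set 'I_d} := [set j | (l < wval h (j, z j))%N].

(* A lower bound for the signed margin under at most k flips (wmargin_flip), which
   rounding makes large for a competitor (wloss_competitor).  None is the constant
   halfspace true, which no nonzero weight can replace. *)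
Definition wmargin h x y : R :=
  let z := signflip y x in
  (if h is None then sgnval y * Mg else 0)
  + (\sum_j (wval h (j, z j))%:R - \sum_j (wval h (j, ~~ z j))%:R)
  - 2 * \sum_(l < m) (minn k #|wlayer h z l|)%:R.

Definition wloss h x y : R := Num.max 0 (Num.min 1 (1 - wmargin h x y / Mg)).

Lemma wval_le h q : (wval h q <= m)%N.
Proof. by case: h => // a; rewrite /wval -ltnS. Qed.

Lemma sum_layers (f : nat) : (f <= m)%N -> (\sum_(l < m) (l < f))%N = f.
Proof.
move=> fm; suff -> : forall M, (\sum_(l < M) (l < f) = minn M f)%N by apply/minn_idPr.
elim=> [|M IHM]; first by rewrite big_ord0 min0n.
by rewrite big_ord_recr /= IHM; case: (ltnP M f) => H /=; lia.
Qed.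

Hypothesis Mg0 : 0 < Mg.

Lemma wloss_ge0 h x y : 0 <= wloss h x y.
Proof. by rewrite le_max lexx. Qed.

Lemma wloss_le1 h x y : wloss h x y <= 1.
Proof. by rewrite ge_max ler01 ge_min lexx. Qed.

Lemma wloss1 h x y : wmargin h x y <= 0 -> wloss h x y = 1.
Proof.
move=> rho0; rewrite /wloss min_l ?max_r //.
by rewrite lerDl oppr_ge0 pmulr_lle0 ?invr_gt0.
Qed.

Lemma wloss0 h x y : Mg <= wmargin h x y -> wloss h x y = 0.
Proof.
move=> rho1; rewrite /wloss max_l // ge_min subr_le0 ler_pdivlMr // mul1r rho1.
by rewrite orbT.
Qed.

Lemma clamp_lip (u v : R) :
  `|Num.max 0 (Num.min 1 (1 - u)) - Num.max 0 (Num.min 1 (1 - v))| <= `|u - v|.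
Proof.
have E t : Num.max 0 (Num.min 1 (1 - t)) = if t <= 0 then 1 else if 1 <= t then 0 else 1 - t :> R.
  case: (lerP t 0) => t0; first by rewrite min_l ?max_r // lerDl oppr_ge0.
  rewrite min_r; last by rewrite gerDl oppr_le0 ltW.
  by case: (lerP 1 t) => t1; [rewrite max_l // subr_le0|rewrite max_r // subr_ge0 ltW].
rewrite !E; have := ler_norm (u - v); have := ler_norm (v - u); rewrite (distrC v u) => A B.
case: (lerP u 0) => ?; case: (lerP v 0) => ?; case: (lerP 1 u) => ?; case: (lerP 1 v) => ?;
  rewrite ler_norml; apply/andP; split; lra.
Qed.

Lemma wloss_contract h h' x x' y : `|wloss h x y - wloss h' x' y| <= `|wmargin h x y - wmargin h' x' y| / Mg.
Proof.
apply: le_trans (clamp_lip _ _) _.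
by rewrite -mulrBl normrM [`|Mg^-1|]gtr0_norm ?invr_gt0.
Qed.

Lemma sum_wval_lip h z z' (f : bool -> bool) :
  \sum_j (wval h (j, f (z j)))%:R <= \sum_j (wval h (j, f (z' j)))%:R + m%:R * (hamming z z')%:R :> R.
Proof.
have -> : m%:R * (hamming z z')%:R = \sum_j (if z j != z' j then m%:R else 0) :> R.
  by rewrite -big_mkcond sumr_const mulr_natr /hamming cardsE.
rewrite -big_split; apply: ler_sum => j _ /=.
case: eqP => [->|_] /=; first by rewrite addr0.
by rewrite ler_wpDl // ler_nat wval_le.
Qed.

Lemma wlayer_lip h z z' l : (minn k #|wlayer h z l| <= minn k #|wlayer h z' l| + hamming z z')%N.
Proof.
rewrite addn_minl leq_min; apply/andP; split; first by rewrite geq_min leq_addr.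
rewrite geq_min; apply/orP; right.
apply: leq_trans (leq_card_setU _ _); apply: subset_leq_card.
apply/fintype.subsetP => j; rewrite /wlayer !inE.
by case: eqP => [->|_]; rewrite ?orbT ?orbF.
Qed.

(** One changed coordinate moves each of the two linear sums by at most [m] and each of the [m]
    layers, counted twice, by at most 1. *)
Lemma wmargin_lip h x x' y :
  `|wmargin h x y - wmargin h x' y| <= 4 * m%:R * (hamming x x')%:R.
Proof.
have le1 u v : wmargin h u y - wmargin h v y <= 4 * m%:R * (hamming u v)%:R.
  have := sum_wval_lip h (signflip y u) (signflip y v) id.
  have := sum_wval_lip h (signflip y v) (signflip y u) negb.
  rewrite /wmargin (hammingC (signflip y v)) !hamming_signflip /=.
  have : \sum_(l < m) (minn k #|wlayer h (signflip y v) l|)%:R <=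
     \sum_(l < m) (minn k #|wlayer h (signflip y u) l|)%:R + m%:R * (hamming u v)%:R :> R.
    have -> : m%:R * (hamming u v)%:R = \sum_(l < m) (hamming u v)%:R :> R.
      by rewrite sumr_const card_ord mulr_natl.
    rewrite -big_split; apply: ler_sum => l _ /=.
    by rewrite -natrD ler_nat hammingC -(hamming_signflip y) wlayer_lip.
  lra.
rewrite ler_norml le1 andbT; have := le1 x' x; rewrite hammingC; lra.
Qed.

Lemma inner_wval h z : inner (fun j => (wval h (j, true))%:R - (wval h (j, false))%:R : R) z =
  \sum_j (wval h (j, z j))%:R - \sum_j (wval h (j, ~~ z j))%:R.
Proof.
rewrite -sumrB; apply: eq_bigr => j _.
by case: (z j) => /=; rewrite ?mulr1 // mulrN1 opprB.
Qed.

(** A flipped coordinate costs at most twice its entry [wval h (j, z j)]. Counted by levels, at most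
    [k] flips meet each layer at most [k] times, and no more often than its size. *)
Lemma wmargin_flip (a : weights) x x' y : (hamming x' x <= k)%N ->
  wmargin (Some a) x y <=
  sgnval y * inner (fun j => (wval (Some a) (j, true))%:R - (wval (Some a) (j, false))%:R : R) x'.
Proof.
move=> xk; rewrite -inner_signflip inner_wval /wmargin add0r.
set h := Some a; set z := signflip y x; set z' := signflip y x'.
suff : \sum_j (wval h (j, z j))%:R - \sum_j (wval h (j, ~~ z j))%:R -
   (\sum_j (wval h (j, z' j))%:R - \sum_j (wval h (j, ~~ z' j))%:R) <=
   2 * \sum_(l < m) (minn k #|wlayer h z l|)%:R :> R by lra.
apply: (@le_trans _ _ (2 * \sum_(j | z' j != z j) (wval h (j, z j))%:R)).
  rewrite -!sumrB big_distrr [leRHS]big_mkcond; apply: ler_sum => j _ /=.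
  case: (altP (z' j =P z j)) => [->|]; first by rewrite subrr.
  have := ler0n R (wval h (j, ~~ z j)); case: (z j); case: (z' j) => //= ? _; lra.
rewrite ler_pM2l // -!natr_sum ler_nat.
under eq_bigr => j _ do rewrite -(sum_layers (wval_le h _)).
rewrite exchange_big; apply: leq_sum => l _ /=.
rewrite leq_min; apply/andP; split.
  rewrite -(hamming_signflip y) -/z -/z' in xk; apply: leq_trans xk.
  rewrite /hamming -sum1_card; under [X in (_ <= X)%N]eq_bigl => j do rewrite inE.
  by apply: leq_sum => j _; case: (l < _)%N.
rewrite -sum1_card; under [X in (_ <= X)%N]eq_bigl => j do rewrite inE.
rewrite [X in (X <= _)%N]big_mkcond [X in (_ <= X)%N]big_mkcond /=.
by apply: leq_sum => j _; case: (_ != _); case: (_ < _)%N.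
Qed.

Lemma whyp_halfspace h : is_halfspace R (whyp h).
Proof. by eexists. Qed.

Lemma wloss_robust (gamma' : R) h (r : record d) : 0 <= gamma' ->
  k = Num.truncn (gamma' * d%:R) ->
  (if [exists xc : cube d, (whyp h xc != r.2) && ((hamming xc r.1)%:R <= gamma' * d%:R)]
     then 1 else 0) <= wloss h r.1 r.2.
Proof.
move=> g0 kE; case: ifP => [|_]; last exact: wloss_ge0.
case/existsP => xc /andP[hx xg].
have {}xg : (hamming xc r.1 <= k)%N by rewrite kE truncn_ge_nat // mulr_ge0.
rewrite wloss1 //.
move: hx; rewrite /whyp ffunE; case: h => [a|] /=.
  move=> hx; apply: le_trans (wmargin_flip a r.2 xg) _ => /=.
  by move: hx; case: r.2 => /=; [rewrite eqb_id -ltNge mul1r => /ltW|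
     rewrite eqbF_neg negbK mulN1r oppr_le0].
rewrite /inner big1 => [|j _]; last by rewrite subrr mul0r.
rewrite lexx => r2; rewrite /wmargin /= !big1 // => [|l _].
  by rewrite mulr0 !subr0 addr0; move: r2; case: r.2 => //= _; rewrite mulN1r oppr_le0 ltW.
have -> : wlayer None (signflip r.2 r.1) l = finset.set0.
  by apply/finset.setP => j; rewrite /wlayer !inE.
by rewrite cards0 minn0.
Qed.

(** The linear part contributes [Mg] for [None] and [m] for each of the [2 d] signed coordinates.
    Since [minn k] is 1-Lipschitz, contraction makes each layer linear too, at cost [4 d]. The total
    is [Mg + 2 d m + 4 d m]. *)
Lemma Rad_wmargin (T : finType) (D : T -> R) n (c : R) (px : T -> cube d) (py : T -> bool) :
  (forall s, 0 <= D s) -> \sum_s D s = 1 -> (0 < n)%N -> 0 <= c ->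
  Rad None D (fun s h => c * wmargin h (px s) (py s)) n <=
  c * (Mg + 6 * d%:R * m%:R) * Num.sqrt n%:R.
Proof.
move=> D0 D1 n0 c0.
pose Q := (unit + 'I_d * bool)%type.
pose V (q : Q) : R := if q is inr _ then c * m%:R else c * Mg.
pose v (q : Q) h : R := if q is inr p then c * ((wval h p)%:R - (wval h (p.1, ~~ p.2))%:R)
  else if h is None then c * Mg else 0.
pose e (q : Q) s : R := if q is inr p then (signflip (py s) (px s) p.1 == p.2)%:R
  else sgnval (py s).
pose lay (l : 'I_m) s h : R := - 2 * c * (minn k #|wlayer h (signflip (py s) (px s)) l|)%:R.
have unitE (F : unit -> R) : \sum_u F u = F tt by rewrite (big_pred1 tt) //; case.
have -> : (fun s h => c * wmargin h (px s) (py s)) =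
   (fun s h => (\sum_q v q h * e q s) + \sum_l lay l s h).
  apply/funext => s; apply/funext => h; rewrite /wmargin big_sumType unitE /= sum_pair -sumrB.
  rewrite mulrBr mulrDr !big_distrr /=; congr (_ + _ + _).
  - by case: h => [a|]; rewrite ?mulr0 ?mul0r //; ring.
  - apply: eq_bigr => j _; rewrite big_bool.
    by case: (signflip _ _ j) => /=; ring.
  - by rewrite -sumrN; apply: eq_bigr => l _; rewrite /lay; ring.
apply: le_trans (RadD _ _ _ n D0) _.
have A : Rad None D (fun s h => \sum_q v q h * e q s) n <= (\sum_q V q) * Num.sqrt n%:R.
  apply: Rad_linear => //.
    case=> [[]|[j b]] h /=; first by case: h => [a|]; rewrite ?normr0 ?mulr_ge0 ?ger0_norm // ?mulr_ge0 // ltW.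
    rewrite normrM ger0_norm //; apply: ler_wpM2l => //.
    have := wval_le h (j, b); have := wval_le h (j, ~~ b); rewrite -!(ler_nat R).
    have := ler0n R (wval h (j, b)); have := ler0n R (wval h (j, ~~ b)).
    by rewrite ler_norml => ? ? ? ?; apply/andP; split; lra.
  case=> [[]|[j b]] s /=; last by case: eqP; rewrite ?normr1 ?normr0.
  by case: (py s); rewrite /= ?normrN normr1.
have B (l : 'I_m) : Rad None D (lay l) n <= (4 * c * d%:R) * Num.sqrt n%:R.
  pose v' (q : 'I_d * bool) h : R := if (l < wval h q)%N then 2 * c else 0.
  pose e' (q : 'I_d * bool) s : R := (signflip (py s) (px s) q.1 == q.2)%:R.
  have E s h : \sum_q v' q h * e' q s = 2 * c * #|wlayer h (signflip (py s) (px s)) l|%:R.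
    rewrite sum_pair -sum1_card natr_sum big_distrr [RHS]big_mkcond /=; apply: eq_bigr => j _.
    rewrite big_bool /v' /e' /wlayer inE /=.
    by case: (signflip _ _ j) => /=; rewrite mulr1 mulr0 ?addr0 ?add0r; case: ifP => _; rewrite ?mulr1.
  apply: (@le_trans _ _ (Rad None D (fun s h => \sum_q v' q h * e' q s) n)).
    apply: Rad_contract => // s h h'; rewrite !E /lay -!mulrBr !normrM normrN.
    apply: ler_wpM2l; first by rewrite mulr_ge0.
    rewrite ler_norml -opprB; set p := #|_|; set q := #|_|.
    have H (u u' : nat) : (minn k u)%:R - (minn k u')%:R <= `|u%:R - u'%:R| :> R.
      case: (leqP u u') => uu.
        apply: le_trans (normr_ge0 _); rewrite subr_le0 ler_nat leq_min geq_minl.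
        by rewrite (leq_trans (geq_minr _ _)).
      apply: le_trans (ler_norm _).
      by rewrite -!natrB ?ler_nat; lia.
    by rewrite opprB lerNl opprB {1}distrC !H.
  have -> : 4 * c * d%:R = \sum_(q : 'I_d * bool) 2 * c.
    by rewrite sumr_const card_prod card_ord card_bool mulrnA -(mulr_natr (_ *+ _)) -(mulr_natr _ d); ring.
  apply: Rad_linear => // [q h|q s].
    by rewrite /v'; case: ifP; rewrite ?normr0 ?ger0_norm // mulr_ge0.
  by rewrite /e'; case: eqP; rewrite ?normr1 ?normr0.
apply: le_trans (lerD A (Rad_sum None lay n D0)) _.
apply: le_trans (lerD (lexx _) (ler_sum _ (fun l _ => B l))) _.
rewrite sumr_const card_ord -[X in _ + X]mulr_natr /V big_sumType unitE /= sumr_const.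
rewrite card_prod card_ord card_bool mulrnA -(mulr_natr (_ *+ _)) -(mulr_natr _ d).
by rewrite le_eqVlt; apply/orP; left; apply/eqP; ring.
Qed.

(** The debiased loss involves the margins at a label and at its negation. They are separated before
    contraction through the ramp, with coefficients [c1 + c2 = 2 / eta]. *)
Lemma wloss_gap (D : record d -> R) (eta : R) n :
  0 < eta -> eta < 1 -> (forall s, 0 <= D s) -> \sum_s D s = 1 -> (0 < n)%N ->
  Ex D (fun S : n.-tuple (record d) => maxv None (fun g => \sum_(i < n)
       (\sum_t D t * debias eta (wloss g) t - debias eta (wloss g) (tnth S i)))) <=
  2 / (eta * Mg) * (Mg + 6 * d%:R * m%:R) * Num.sqrt n%:R.
Proof.
move=> e0 e1 D0 D1 n0; have M0 := Mg0.
apply: le_trans (Rad_symmetrize None (fun s g => debias eta (wloss g) s) n D0 D1) _.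
pose c1 := (1 + eta) / eta; pose c2 := (1 - eta) / eta.
have c10 : 0 <= c1 by rewrite divr_ge0 //; lra.
have c20 : 0 <= c2 by rewrite divr_ge0 //; lra.
have -> : (fun s g => 2 * debias eta (wloss g) s) =
    (fun s g => c1 * wloss g s.1 s.2 + - c2 * wloss g s.1 (~~ s.2)).
  by apply/funext => s; apply/funext => g; rewrite /debias /c1 /c2; field; rewrite gt_eqF.
apply: le_trans (RadD _ _ _ n D0) _.
have C (c c' : R) (f : bool -> bool) : 0 <= c -> `|c'| = c ->
    Rad None D (fun s g => c' * wloss g s.1 (f s.2)) n <=
    c / Mg * (Mg + 6 * d%:R * m%:R) * Num.sqrt n%:R.
  move=> c0 cc; apply: le_trans (Rad_wmargin fst (fun s => f s.2) D0 D1 n0 _); last first.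
    by rewrite divr_ge0 // ltW.
  apply: Rad_contract => // s h h'; rewrite -!mulrBr !normrM cc (ger0_norm c0) [`|Mg^-1|]gtr0_norm ?invr_gt0 //.
  by rewrite -mulrA; apply: ler_wpM2l => //; rewrite mulrC; exact: wloss_contract.
have C1 := C c1 c1 id c10 (ger0_norm c10).
have C2 := C c2 (- c2) negb c20 (etrans (normrN _) (ger0_norm c20)).
apply: le_trans (lerD C1 C2) _.
rewrite le_eqVlt; apply/orP; left; apply/eqP; rewrite /c1 /c2; field.
by rewrite !gt_eqF.
Qed.

Lemma wloss_lip h x x' y : `|wloss h x y - wloss h x' y| <= 4 * m%:R / Mg * (hamming x x')%:R.
Proof.
apply: le_trans (wloss_contract _ _ _ _ _) _; rewrite ler_pdivrMr //.
by apply: le_trans (wmargin_lip _ _ _ _) _; rewrite le_eqVlt; apply/orP; left; apply/eqP; field; rewrite gt_eqF.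
Qed.

(** Only records where [w] is robust matter, as the loss never exceeds 1. There the truncated
    weights, scaled by [m / t], keep a margin [2 * Mg] under [k] flips, and rounding down costs at
    most [d <= Mg]. *)
Lemma wloss_competitor (w : 'I_d -> R) (gamma : R) (K q : nat) :
  (0 < d)%N -> (0 < q)%N -> (k + 2 * q <= K)%N -> (K <= d)%N ->
  K%:R <= gamma * d%:R -> Mg = m%:R * q%:R ^+ 2 / (2 * d%:R) ->
  2 * d%:R ^+ 2 <= m%:R * q%:R ^+ 2 :> R ->
  exists h, forall r : record d, wloss h r.1 r.2 <=
    (if [exists xc : cube d, (halfspace w xc != r.2) && ((hamming xc r.1)%:R <= gamma * d%:R)]
     then 1 else 0).
Proof.
move=> d0 q0 kqK Kd Kg MgE mq; have M0 := Mg0.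
have qd : (q <= d)%N by lia.
have kd : (k <= d)%N by lia.
have rob (r : record d) : ~~ [exists xc : cube d, (halfspace w xc != r.2) && ((hamming xc r.1)%:R <= gamma * d%:R)] ->
    forall z', (hamming z' (signflip r.2 r.1) <= K)%N -> 0 <= inner w z'.
  move=> /existsPn H z' hz; have /negP := H (signflip r.2 z').
  rewrite -{1}(signflipK r.2 r.1) hamming_signflip (le_trans _ Kg) ?ler_nat // andbT => /negP.
  rewrite negbK ffunE inner_signflip; case: r.2 => /=.
    by rewrite mul1r eqb_id.
  by rewrite mulN1r eqbF_neg -ltNge oppr_lt0 => /ltW.
have hN (h : option weights) : (forall r : record d,
    (forall z', (hamming z' (signflip r.2 r.1) <= K)%N -> 0 <= inner w z') ->
    ~~ [exists xc : cube d, (halfspace w xc != r.2) && ((hamming xc r.1)%:R <= gamma * d%:R)] ->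
    Mg <= wmargin h r.1 r.2) ->
  exists h, forall r : record d, wloss h r.1 r.2 <=
    (if [exists xc : cube d, (halfspace w xc != r.2) && ((hamming xc r.1)%:R <= gamma * d%:R)]
     then 1 else 0).
  move=> H; exists h => r; case: (boolP [exists xc, _]) => [_|E]; first exact: wloss_le1.
  by rewrite wloss0 //; apply: H => //; exact: rob.
case: (pselect (exists j, w j != 0)) => [w0|wE]; last first.
  apply: (hN None) => r _ /existsPn/(_ r.1).
  have -> : halfspace w r.1 = true.
    rewrite ffunE /inner big1 ?lexx // => j _; case: (eqVneq (w j) 0) => [->|jw]; first by rewrite mul0r.
    by case: wE; exists j.
  rewrite (_ : hamming r.1 r.1 = 0%N); last by apply: eq_card0 => j; rewrite inE eqxx.
  rewrite (le_trans _ Kg) ?ler0n // andbT negbK => /eqP <-.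
  rewrite /wmargin /= mul1r !big1 // => [|l _]; first by rewrite subrr addr0 mulr0 subr0.
  have -> : wlayer None (signflip true r.1) l = finset.set0.
    by apply/finset.setP => j; rewrite /wlayer !inE.
  by rewrite cards0 minn0.
have [T [t [Tq t0 tT Tt]]] : exists (T : {set 'I_d}) (t : R), [/\ #|T| = q, 0 <= t,
    forall j, j \in T -> t <= `|w j| & forall j, j \notin T -> `|w j| <= t].
  have [T [t [Tq tT Tt]]] := exists_topset (fun j => `|w j|) d0 qd.
  exists T, (Num.max 0 t); split=> // [|j jT|j jT]; first by rewrite le_max lexx.
    by rewrite ge_max normr_ge0 tT.
  by rewrite le_max Tt ?orbT.
move: t0; rewrite le_eqVlt => /predU1P[t0|t0].
  (* At [t = 0] at most [q <= K] weights are nonzero, so [w] is robust nowhere and any competitor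
     will do. *)
  apply: (hN None) => r rb _; exfalso; apply: (@not_robust R d w T K _ _ _ w0 rb).
    by rewrite Tq; lia.
  by move=> j /Tt; rewrite -t0 normr_le0 => /eqP.
pose wt j := Num.sg (w j) * Num.min `|w j| t.
(* Positive and negative parts of the truncated weight, scaled to [0, 1]. *)
pose u (p : 'I_d * bool) : R := Num.max 0 (wt p.1 * sgnval p.2) / t.
have u0 p : 0 <= u p by rewrite divr_ge0 ?le_max ?lexx // ltW.
have wt_le j : `|wt j| <= t.
  rewrite normrM normr_sg [X in _ * X]ger0_norm; last by rewrite le_min normr_ge0 ltW.
  by case: (w j != 0); rewrite ?mul1r ?mul0r ?ge_min ?lexx ?orbT // ltW.
have u1 p : u p <= 1.
  rewrite ler_pdivrMr // mul1r ge_max ltW //=; have := wt_le p.1; rewrite ler_norml => /andP[A B].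
  by case: p.2 => /=; rewrite ?mulr1 ?mulrN1 // lerNl.
pose a : weights := [ffun p => inord (Num.truncn (m%:R * u p))].
have valE p : wval (Some a) p = Num.truncn (m%:R * u p).
  rewrite /wval ffunE inordK // ltnS -(ler_nat R).
  apply: le_trans (_ : m%:R * u p <= _); first by rewrite truncn_le // mulr_ge0.
  by rewrite ler_piMr.
have val_le p : (wval (Some a) p)%:R <= m%:R * u p by rewrite valE truncn_le // mulr_ge0.
have val_ge p : m%:R * u p - 1 <= (wval (Some a) p)%:R.
  by rewrite lerBlDr natr1 valE ltW // truncnS_gt.
have val0 j b : w j * sgnval b <= 0 -> wval (Some a) (j, b) = 0%N.
  move=> wb; rewrite valE /u /wt max_l ?mul0r ?mulr0 ?truncn0 //=.
  have mn : 0 <= Num.min `|w j| t by rewrite le_min normr_ge0 ltW.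
  rewrite mulrAC mulr_le0_ge0 //; move: wb; case: b => /=; rewrite ?mulr1 ?mulrN1 ?oppr_le0 ?sgr_le0 ?sgr_ge0 //.
apply: (hN (Some a)) => r rb _; set z := signflip r.2 r.1 in rb *.
have [B [s [Bk sB Bs]]] := exists_topset (fun j => (wval (Some a) (j, z j))%:R : R) d0 kd.
set B' := B :&: [set j | 0 < w j * sgnval (z j)].
have B'k : (#|B'| <= k)%N by rewrite -Bk subset_leq_card // subsetIl.
have := truncated_margin d0 qd kqK Tq (ltW t0) tT Tt B'k rb; rewrite -/wt.
set z1 := flip B' z => marg.
(* [B] carries the [k] largest values, so each layer either lies in [B] or contains it. *)
have layers : (\sum_(l < m) minn k #|wlayer (Some a) z l| <= \sum_(j in B) wval (Some a) (j, z j))%N.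
  under [X in (_ <= X)%N]eq_bigr => j _ do rewrite -(sum_layers (wval_le (Some a) _)).
  rewrite exchange_big; apply: leq_sum => l _ /=.
  have -> : (\sum_(j in B) (l < wval (Some a) (j, z j)) = #|B :&: wlayer (Some a) z l|)%N.
    rewrite -sum1_card [RHS]big_mkcond [LHS]big_mkcond; apply: eq_bigr => j _ /=.
    by rewrite !inE; case: (j \in B); case: (l < _)%N.
  case: (boolP (wlayer (Some a) z l \subset B)) => [/finset.setIidPr ->|]; first exact: geq_minr.
  case/subsetPn => j; rewrite inE => lj jB.
  have /finset.setIidPl -> : B \subset wlayer (Some a) z l.
    apply/fintype.subsetP => i iB; rewrite inE; apply: leq_trans lj _.
    by rewrite -(ler_nat R); apply: le_trans (Bs _ jB) (sB _ iB).
  by rewrite Bk geq_minl.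
rewrite -(ler_nat R) !natr_sum in layers.
(* By [val0] one of the two entries of each coordinate vanishes, so flipping [B'] loses exactly
   twice the weight on [B]. *)
have flipE : \sum_j (wval (Some a) (j, z j))%:R - \sum_j (wval (Some a) (j, ~~ z j))%:R
    - 2 * \sum_(j in B) (wval (Some a) (j, z j))%:R =
    \sum_j ((wval (Some a) (j, z1 j))%:R - (wval (Some a) (j, ~~ z1 j))%:R) :> R.
  rewrite -sumrB [\sum_(j in B) _]big_mkcond big_distrr -sumrB; apply: eq_bigr => j _ /=.
  have -> : z1 j = (j \in B') (+) z j by rewrite ffunE.
  rewrite /B' !inE; case: (j \in B) => /=; last by rewrite mulr0 subr0.
  case: ltP => [wz|wz] /=; last by rewrite (val0 _ _ wz) mulr0 subr0.
  rewrite negbK (val0 j (~~ z j)); last by rewrite sgnval_contra mulrN oppr_le0 ltW.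
  by ring.
have rounding : m%:R / t * inner wt z1 - d%:R <=
    \sum_j ((wval (Some a) (j, z1 j))%:R - (wval (Some a) (j, ~~ z1 j))%:R) :> R.
  have -> : d%:R = \sum_(j < d) 1 :> R by rewrite sumr_const card_ord.
  rewrite /inner big_distrr -sumrB; apply: ler_sum => j _ /=.
  have := val_ge (j, z1 j); have := val_le (j, ~~ z1 j).
  have : m%:R * u (j, z1 j) - m%:R * u (j, ~~ z1 j) = m%:R / t * (wt j * sgnval (z1 j)).
    rewrite /u /= sgnval_contra mulrN -mulrBr -mulrBl.
    suff -> : Num.max 0 (wt j * sgnval (z1 j)) - Num.max 0 (- (wt j * sgnval (z1 j))) =
      wt j * sgnval (z1 j) by field; rewrite gt_eqF.
    by case: (leP 0 (wt j * _)) => X; [rewrite max_l ?subr0 // oppr_le0|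
      rewrite max_r ?sub0r ?opprK // oppr_ge0 ltW].
  lra.
have dR : 0 < d%:R :> R by rewrite ltr0n.
have Mgd : d%:R <= Mg by rewrite MgE ler_pdivlMr ?mulr_gt0 //; move: mq; rewrite expr2; lra.
have Mg2 : 2 * Mg <= m%:R / t * inner wt z1.
  rewrite -(ler_pM2r (mulr_gt0 dR t0)) MgE.
  have -> : 2 * (m%:R * q%:R ^+ 2 / (2 * d%:R)) * (d%:R * t) = m%:R * (q%:R ^+ 2 * t).
    by field; rewrite gt_eqF.
  have -> : m%:R / t * inner wt z1 * (d%:R * t) = m%:R * (d%:R * inner wt z1).
    by field; rewrite gt_eqF.
  exact: ler_wpM2l.
rewrite /wmargin add0r -/z; lra.
Qed.

End IntegerWeights.

(** * Counting halfspaces, and the two regimes *)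

Section ChowParameters.
Variables (R : realType) (d : nat).

(** The cardinals of these sets are the Chow parameters in counting form, [None] giving the constant
    coefficient. *)
Definition chow_set (h : hyp d) (o : option 'I_d) : {set cube d} :=
  [set x | h x && (if o is Some j then x j else true)].

Lemma sum_inner_chow (w : 'I_d -> R) (h : hyp d) :
  \sum_(x | h x) inner w x =
  \sum_j w j * (2 * #|chow_set h (Some j)|%:R - #|chow_set h None|%:R).
Proof.
rewrite exchange_big; apply: eq_bigr => j _ /=; rewrite -big_distrr /=; congr (_ * _).
rewrite -!sum1_card !natr_sum.
under [X in _ = 2 * X - _]eq_bigl do rewrite inE.
under [X in _ = _ - X]eq_bigl do rewrite inE andbT.
rewrite big_mkcondr big_distrr -sumrB; apply: eq_bigr => x _ /=.
by case: (x j) => /=; lra.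
Qed.

(* Chow: the sum of (h - g) * inner w has nonnegative terms, positive where
   h x = false and g x = true, and it only depends on the Chow parameters. *)
Lemma chow_inj (w : 'I_d -> R) (g : hyp d) :
  (forall o, #|chow_set (halfspace w) o| = #|chow_set g o|) -> halfspace w = g.
Proof.
move=> E; set h := halfspace w in E *.
have S : \sum_x ((h x)%:R - (g x)%:R) * inner w x = 0.
  transitivity (\sum_(x | h x) inner w x - \sum_(x | g x) inner w x); last first.
    rewrite !sum_inner_chow E; under eq_bigr do rewrite E; exact: subrr.
  rewrite [X in _ = X - _]big_mkcond [X in _ = _ - X]big_mkcond -sumrB; apply: eq_bigr => x _ /=.
  by case: (h x); case: (g x); rewrite /=; ring.
have ge0 x : 0 <= ((h x)%:R - (g x)%:R) * inner w x.
  rewrite /h ffunE; case: (lerP 0 (inner w x)) => I; case: (g x) => /=.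
  - by rewrite subrr mul0r.
  - by rewrite subr0 mul1r.
  - by rewrite sub0r mulN1r oppr_ge0 ltW.
  - by rewrite subrr mul0r.
have gh : chow_set g None \subset chow_set h None.
  apply/fintype.subsetP => x; rewrite !inE !andbT => gx; apply: contraT => hx.
  have /eqP := S; rewrite psumr_eq0 // => /allP/(_ x (mem_index_enum _)) /=.
  rewrite gx (negbTE hx) sub0r mulN1r oppr_eq0 => /eqP I.
  by move: hx; rewrite ffunE I lexx.
have /eqP hg : chow_set g None == chow_set h None by rewrite eqEcard gh E leqnn.
apply/ffunP => x; have : (x \in chow_set g None) = (x \in chow_set h None) by rewrite hg.
by rewrite !inE !andbT.
Qed.

Definition halfspaces := {h : hyp d | `[<is_halfspace R h>]}.

Lemma chow_set_bound (h : hyp d) o : (#|chow_set h o| < (2 ^ d).+1)%N.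
Proof. by rewrite ltnS (leq_trans (max_card _)) // card_ffun card_bool card_ord. Qed.

(** By [chow_inj] a halfspace is determined by [d + 1] numbers between 0 and [2 ^ d]. *)
Lemma card_halfspaces : (#|{: halfspaces}| <= (2 ^ d.+1) ^ d.+1)%N.
Proof.
pose f (h : halfspaces) : {ffun option 'I_d -> 'I_(2 ^ d).+1} :=
  [ffun o => Ordinal (chow_set_bound (val h) o)].
apply: (@leq_trans #|{ffun option 'I_d -> 'I_(2 ^ d).+1}|).
  apply: (leq_card f) => h g /ffunP fE; apply: val_inj.
  have /asboolP[w hw] := valP h; rewrite hw; apply: chow_inj => o.
  by have := fE o; rewrite !ffunE -hw => /(congr1 val).
rewrite card_ffun card_option !card_ord leq_exp2r //.
by rewrite expnS mul2n -addnn -addn1 leq_add2l expn_gt0.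
Qed.

Lemma ln_card_halfspaces : ln #|{: halfspaces}|%:R <= (d.+1%:R) ^+ 2 :> R.
Proof.
have h0 : (0 < #|{: halfspaces}|)%N.
  apply/card_gt0P; exists (exist _ (halfspace (fun=> 0)) (asboolT (ex_intro _ (fun=> 0 : R) erefl)) : halfspaces).
  by [].
have ln2 : ln 2 <= 1 :> R.
  have := le_ln1Dx (x := 1 : R); rewrite -[1 + 1]/2%:R; apply; lra.
apply: (@le_trans _ _ (ln ((2 ^ d.+1) ^ d.+1)%:R)).
  by rewrite ler_ln ?posrE ?ltr0n ?expn_gt0 // ler_nat card_halfspaces.
rewrite !natrX !lnXn ?exprn_gt0 // -mulrnA -[_ *+ _]mulr_natl natrM -expr2.
by apply: ler_piMr => //; rewrite exprn_ge0.
Qed.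

End ChowParameters.

(** * Choice of the parameters in the two regimes *)

Section Assembly.
Variable R : realType.

Lemma rr_gibbs_excess (eps gamma gamma' : R) (d n : nat) (H : finType) (h0 : H)
    (hy : H -> hyp d) (l : H -> cube d -> bool -> R) (B gap : R) :
  0 < eps <= 1 -> (0 < n)%N -> 0 < B ->
  (forall h, is_halfspace R (hy h)) ->
  (forall h x x' y, `|l h x y - l h x' y| <= B * (hamming x x')%:R) ->
  (forall g r, (if [exists xc : cube d, (hy g xc != r.2) && ((hamming xc r.1)%:R <= gamma' * d%:R)]
     then 1 else 0) <= l g r.1 r.2) ->
  (forall w : 'I_d -> R, exists h, forall r : record d, l h r.1 r.2 <=
    if [exists xc : cube d, (halfspace w xc != r.2) && ((hamming xc r.1)%:R <= gamma * d%:R)]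
    then 1 else 0) ->
  (forall D : record d -> R, (forall s, 0 <= D s) -> \sum_s D s = 1 ->
    Ex D (fun S : n.-tuple (record d) => maxv h0 (fun g => \sum_(i < n)
       (\sum_t D t * debias (eps / 3) (l g) t - debias (eps / 3) (l g) (tnth S i)))) <= gap) ->
  exists M : mechanism R d n,
    valid_halfspace_mech M /\ nabla0_DP eps M /\
    forall D : {ffun record d -> R}, is_pmf D -> forall w : 'I_d -> R,
      expected_robust_err M gamma' D <= robust_err gamma (halfspace w) D
        + (gap + 6 * B * ln #|H|%:R / eps ^+ 2) / n%:R.
Proof.
move=> /andP[e0 e1] n0 B0 hyH lip rob comp gapP.
(* For [eps <= 1] one has [1 + eta <= (1 + eps) * (1 - eta)], which pays for a label; [la] solves
   [2 * la * (B / eta) = eps], which pays for a coordinate. *)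
pose eta := eps / 3; pose la := eps ^+ 2 / (6 * B).
have eta0 : 0 < eta by rewrite divr_gt0.
have eta1 : eta < 1 by rewrite /eta; lra.
have la0 : 0 < la by rewrite divr_gt0 ?exprn_gt0 ?mulr_gt0.
exists (rr_gibbs eta la hy l); split; first exact: rr_gibbs_valid.
split.
  apply: (rr_gibbs_DP eta0 eta1 hy la0 (B := B)) => //.
  - exact: ltW.
  - have := expR_ge1Dx eps => E; have : 0 <= 1 - eta by lra.
    by move=> /(ler_wpM2r)/(_ _ _ E); apply: le_trans; rewrite /eta; nra.
  - by rewrite le_eqVlt; apply/orP; left; apply/eqP; rewrite /la /eta; field; rewrite !gt_eqF.
move=> D Dpmf w; have [h hw] := comp w; have [D0 D1] := Dpmf.
apply: le_trans (rr_gibbs_utility eta0 eta1 h0 la0 h n0 Dpmf rob) _.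
apply: lerD; first by apply: ler_sum => r _; apply: ler_wpM2l.
apply: ler_wpM2r; first by rewrite invr_ge0 ler0n.
apply: lerD; first by apply: gapP; [exact: noisy_ge0|rewrite noisy_sum].
by rewrite le_eqVlt; apply/orP; left; apply/eqP; rewrite /la; field; rewrite !gt_eqF.
Qed.

Lemma debias_bound (d : nat) (eta : R) (l : cube d -> bool -> R) s :
  0 < eta -> eta < 1 -> (forall x y, 0 <= l x y <= 1) -> `|debias eta l s| <= eta^-1.
Proof.
move=> e0 e1 l01; rewrite /debias normrM [`|(_ * _)^-1|]gtr0_norm ?invr_gt0 ?mulr_gt0 //.
rewrite ler_pdivrMr ?mulr_gt0 // mulrCA mulVf ?gt_eqF // mulr1.
have /andP[A0 A1] := l01 s.1 s.2; have /andP[B0 B1] := l01 s.1 (~~ s.2).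
rewrite ler_norml; apply/andP; split; nra.
Qed.

(** All halfspaces compete with the exact indicator of a [gamma']-robust error as loss. Distinct
    points are at distance at least 1, so its Lipschitz constant is 1, and [w] is its own
    competitor. *)
Lemma small_dimension (eps gamma gamma' : R) (d n : nat) :
  0 < eps <= 1 -> gamma' <= gamma -> (0 < n)%N ->
  exists M : mechanism R d n,
    valid_halfspace_mech M /\ nabla0_DP eps M /\
    forall D : {ffun record d -> R}, is_pmf D -> forall w : 'I_d -> R,
      expected_robust_err M gamma' D <= robust_err gamma (halfspace w) D
        + (12 / eps * Num.sqrt n%:R * ((d.+1%:R) ^+ 2 + 1) + 6 * (d.+1%:R) ^+ 2 / eps ^+ 2) / n%:R.
Proof.
move=> e01 gg n0; have /andP[e0 e1] := e01.
pose H := halfspaces R d.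
pose h0 : H := exist _ (halfspace (fun=> 0)) (asboolT (ex_intro _ (fun=> 0 : R) erefl)).
pose l (h : H) x y : R := if [exists xc : cube d, (val h xc != y) && ((hamming xc x)%:R <= gamma' * d%:R)]
     then 1 else 0.
have l01 h x y : 0 <= l h x y <= 1 by rewrite /l; case: ifP; rewrite ?lexx ?ler01.
pose gap : R := 12 / eps * Num.sqrt n%:R * ((d.+1%:R) ^+ 2 + 1).
have [||||D D0 D1|M [Mv [MD Me]]] := @rr_gibbs_excess eps gamma gamma' d n H h0 val l 1 gap e01 n0 ltr01.
- by move=> h; have /asboolP := valP h.
- move=> h x x' y; rewrite mul1r; case: (eqVneq x x') => [->|xx]; first by rewrite subrr normr0.
  have hx : (0 < hamming x x')%N.
    rewrite lt0n; apply: contraNneq xx => /eqP; rewrite cards_eq0 => /eqP E.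
    apply/eqP/ffunP => j; apply/eqP; apply: contraT => xj.
    by have : j \in finset.set0 by [rewrite -E inE]; rewrite inE.
  apply: (@le_trans _ _ 1); last by rewrite ler1n.
  by have /andP[? ?] := l01 h x y; have /andP[? ?] := l01 h x' y; rewrite ler_norml; apply/andP; split; lra.
- by [].
- move=> w; exists (exist _ (halfspace w) (asboolT (ex_intro _ w erefl))) => r; rewrite /l /=.
  case: ifP => [/existsP[xc /andP[A B]]|_]; last by case: ifP.
  rewrite ifT //; apply/existsP; exists xc; rewrite A (le_trans B) //.
  by rewrite ler_wpM2r.
- have eta0 : 0 < eps / 3 by rewrite divr_gt0.
  have eta1 : eps / 3 < 1 by lra.
  apply: le_trans (Ex_maxv_finite h0 (K := 2 / (eps / 3)) (G := fun t g =>
    \sum_t D t * debias (eps / 3) (l g) t - debias (eps / 3) (l g) t) D0 D1 n0 _ _ _) _.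
  + by rewrite divr_gt0.
  + move=> h; under eq_bigr do rewrite mulrBr.
    by rewrite sumrB -big_distrl /= D1 mul1r subrr.
  + move=> s h; apply: le_trans (ler_normB _ _) _.
    have db t : `|debias (eps / 3) (l h) t| <= (eps / 3)^-1 by apply: debias_bound.
    have -> : 2 / (eps / 3) = (eps / 3)^-1 + (eps / 3)^-1 by field; rewrite gt_eqF.
    apply: lerD => //; apply: le_trans (ler_norm_sum _ _ _) _.
    rewrite -[leRHS]mul1r -[X in _ <= X * _]D1 big_distrl; apply: ler_sum => t _ /=.
    by rewrite normrM (ger0_norm (D0 t)) ler_wpM2l.
  rewrite /gap (_ : 2 * (2 / (eps / 3)) = 12 / eps); last by field; rewrite gt_eqF.
  apply: ler_wpM2l; first by rewrite mulr_ge0 ?sqrtr_ge0 // divr_ge0 // ltW.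
  by rewrite lerD2r ln_card_halfspaces.
exists M; split=> //; split=> // D Dp w; apply: le_trans (Me D Dp w) _.
rewrite lerD2l; apply: ler_wpM2r; first by rewrite invr_ge0.
rewrite lerD2l; apply: ler_wpM2r; first by rewrite invr_ge0 exprn_ge0 // ltW.
by rewrite mulr1 ler_pM2l // ln_card_halfspaces.
Qed.

Lemma half_gap (K k : nat) : (3 < K.+1 - k)%N ->
  let q := ((K - k)./2)%N in
  [/\ (0 < q)%N, (k + 2 * q <= K)%N & (K.+1 - k <= 2 * q + 2)%N].
Proof. by move=> H q; rewrite /q; split; lia. Qed.

Lemma large_dimension (eps gamma gamma' : R) (d n : nat) :
  0 < eps <= 1 -> 0 < gamma <= 1 -> 0 < gamma' <= 1 -> (0 < n)%N ->
  3 <= (gamma - gamma') * d%:R ->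
  exists M : mechanism R d n,
    valid_halfspace_mech M /\ nabla0_DP eps M /\
    forall D : {ffun record d -> R}, is_pmf D -> forall w : 'I_d -> R,
      expected_robust_err M gamma' D <= robust_err gamma (halfspace w) D
        + (6 / eps * Num.sqrt n%:R * (1 + 432 / (gamma - gamma') ^+ 2)
           + 400 * 1000 / eps ^+ 2 / (gamma - gamma') ^+ 4) / n%:R.
Proof.
move=> e01 /andP[g0 g1] /andP[g'0 g'1] n0 Dd; have /andP[e0 e1] := e01.
set Dl := gamma - gamma' in Dd *.
have d0 : (0 < d)%N by rewrite lt0n; apply/eqP => E; move: Dd; rewrite E mulr0; lra.
have dR : 0 < d%:R :> R by rewrite ltr0n.
have Dl0 : 0 < Dl by rewrite -(pmulr_lgt0 _ dR); lra.
pose K : nat := Num.truncn (gamma * d%:R); pose k : nat := Num.truncn (gamma' * d%:R).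
have K1 : K%:R <= gamma * d%:R by rewrite truncn_le mulr_ge0 // ltW.
have K2 : gamma * d%:R < K.+1%:R by rewrite truncnS_gt.
have k1 : k%:R <= gamma' * d%:R by rewrite truncn_le mulr_ge0 // ltW.
have Kd : (K <= d)%N.
  by rewrite -(ler_nat R); apply: le_trans K1 _; rewrite ler_piMl // ltW.
pose q := (K - k)./2.
have Kk : Dl * d%:R < (K.+1 - k)%N%:R.
  have : (k%:R : R) < K.+1%:R by apply: le_lt_trans k1 (lt_trans _ K2); move: Dd; rewrite /Dl; lra.
  rewrite ltr_nat => kK; rewrite natrB; last exact: ltnW.
  by rewrite /Dl; lra.
(* Strictness leaves [K - k >= 3], so that half of it, [q], is positive despite the two
   roundings. *)
have Kk3 : (3 < K.+1 - k)%N by rewrite -(ltr_nat R); apply: le_lt_trans Kk.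
have [q0 kqK q2] := half_gap Kk3; rewrite -/q in q0 kqK q2.
have qR : 0 < q%:R :> R by rewrite ltr0n.
have dq : d%:R / q%:R <= 6 / Dl.
  have : ((K.+1 - k)%N%:R : R) <= 2 * q%:R + 2.
    by rewrite -natrM -natrD ler_nat.
  move=> X; rewrite ler_pdivrMr // mulrAC ler_pdivlMr //; lra.
have dq2 : (d%:R / q%:R) ^+ 2 <= 36 / Dl ^+ 2.
  have -> : 36 / Dl ^+ 2 = (6 / Dl) ^+ 2 by field; rewrite gt_eqF.
  by rewrite lerXn2r ?nnegrE ?divr_ge0 // ltW.
(* Just large enough for [2 d ^ 2 <= m q ^ 2], the condition under which rounding costs at most
   [Mg]. *)
pose m : nat := (Num.truncn (2 * (d%:R / q%:R) ^+ 2 : R)).+1.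
have m1 : 2 * (d%:R / q%:R) ^+ 2 <= m%:R :> R by apply: ltW; exact: truncnS_gt.
have m2 : m%:R <= 73 / Dl ^+ 2.
  have Dl1 : 1 <= 1 / Dl ^+ 2.
    by rewrite ler_pdivlMr ?exprn_gt0 // mul1r; apply: exprn_ile1; [exact: ltW|rewrite /Dl; lra].
  rewrite /m -natr1; have : (Num.truncn (2 * (d%:R / q%:R) ^+ 2 : R))%:R <= 2 * (d%:R / q%:R) ^+ 2 :> R.
    by rewrite truncn_le mulr_ge0 // exprn_ge0 // divr_ge0.
  lra.
have mR : 0 < m%:R :> R by rewrite ltr0n.
pose Mg : R := m%:R * q%:R ^+ 2 / (2 * d%:R).
have Mg0 : 0 < Mg by rewrite divr_gt0 ?mulr_gt0 ?exprn_gt0.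
pose H := option (weights d m).
pose gap : R := 2 / (eps / 3 * Mg) * (Mg + 6 * d%:R * m%:R) * Num.sqrt n%:R.
have B0 : 0 < 4 * m%:R / Mg by apply: divr_gt0 => //; apply: mulr_gt0.
have [||||D D0 D1|M [Mv [MD Me]]] := @rr_gibbs_excess eps gamma gamma' d n H None
  (whyp R (m:=m)) (wloss k Mg) (4 * m%:R / Mg) gap e01 n0 B0.
- exact: whyp_halfspace.
- move=> h x x' y; exact: wloss_lip.
- by move=> h r; apply: wloss_robust => //; exact: ltW.
- move=> w; apply: (wloss_competitor Mg0 w d0 q0 kqK Kd K1) => //.
  by rewrite -ler_pdivrMr ?exprn_gt0 // -mulrA -expr_div_n.
- by apply: wloss_gap => //; [rewrite divr_gt0|lra].
exists M; split=> //; split=> // D Dp w; apply: le_trans (Me D Dp w) _.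
rewrite lerD2l; apply: ler_wpM2r; first by rewrite invr_ge0.
have Mq : d%:R * m%:R / Mg = 2 * (d%:R / q%:R) ^+ 2 by rewrite /Mg; field; rewrite !gt_eqF.
apply: lerD.
  have -> : gap = 6 / eps * Num.sqrt n%:R * (1 + 6 * (d%:R * m%:R / Mg)).
    by rewrite /gap; field; rewrite !gt_eqF.
  apply: ler_wpM2l; first by rewrite mulr_ge0 ?sqrtr_ge0 // divr_ge0 // ltW.
  rewrite Mq; lra.
(* There are [1 + (m + 1) ^ (2 d)] indices, and [ln (m + 1) <= m]. *)
have lnH : ln #|{: H}|%:R <= 3 * (d%:R * m%:R) :> R.
  have dm1 : 1 <= d%:R * m%:R :> R by rewrite -natrM ler1n muln_gt0 d0.
  have ln2 : ln 2 <= 1 :> R.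
    have := le_ln1Dx (x := 1 : R); rewrite -[1 + 1]/2%:R; apply; lra.
  have lnm : ln m.+1%:R <= m%:R :> R.
    by rewrite -natr1 addrC; apply: le_ln1Dx; lra.
  apply: (@le_trans _ _ (ln (2 * m.+1%:R ^+ (d * 2)))).
    rewrite ler_ln ?posrE ?mulr_gt0 ?exprn_gt0 ?ltr0n //; last by apply/card_gt0P; exists None.
    rewrite -natrX -natrM ler_nat card_option card_ffun card_prod !card_ord card_bool.
    by rewrite mul2n -addnn -addn1 leq_add2l expn_gt0.
  rewrite lnM ?posrE ?exprn_gt0 // lnXn // mulrnA -[_ *+ d]mulr_natl.
  have := ler_wpM2l (ltW dR) lnm. lra.
apply: (@le_trans _ _ (72 * (d%:R * m%:R / Mg) * m%:R / eps ^+ 2)).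
  rewrite ler_pM2r ?invr_gt0 ?exprn_gt0 //.
  have := ler_wpM2l (ltW B0) lnH => X.
  have -> : 72 * (d%:R * m%:R / Mg) * m%:R = 6 * (4 * m%:R / Mg * (3 * (d%:R * m%:R))).
    by field; rewrite gt_eqF.
  by rewrite -mulrA ler_pM2l.
rewrite Mq [leRHS]mulrAC ler_pM2r ?invr_gt0 ?exprn_gt0 //.
have -> : 72 * (2 * (d%:R / q%:R) ^+ 2) * m%:R = 144 * ((d%:R / q%:R) ^+ 2 * m%:R) :> R by ring.
have X : (d%:R / q%:R) ^+ 2 * m%:R <= (36 / Dl ^+ 2) * (73 / Dl ^+ 2).
  by apply: ler_pM => //; rewrite exprn_ge0 // divr_ge0.
have Y : 0 <= (1 / Dl ^+ 2) * (1 / Dl ^+ 2) by rewrite mulr_ge0 // divr_ge0 // exprn_ge0 // ltW.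
have -> : 400 * 1000 / Dl ^+ 4 = 400 * 1000 * ((1 / Dl ^+ 2) * (1 / Dl ^+ 2)).
  by field; rewrite gt_eqF.
have Z : (36 / Dl ^+ 2) * (73 / Dl ^+ 2) = 36 * 73 * ((1 / Dl ^+ 2) * (1 / Dl ^+ 2)).
  by field; rewrite gt_eqF.
rewrite Z in X; lra.
Qed.

End Assembly.

Theorem theorem6p2 :
  forall R : realType, exists C : R, 0 < C /\
  forall (eps gamma gamma' : R) (d n : nat),
    0 < eps <= 1 -> 0 < gamma <= 1 -> 0 < gamma' <= 1 -> gamma' < gamma ->
    (0 < n)%N ->
    exists M : mechanism R d n,
      valid_halfspace_mech M /\ nabla0_DP eps M /\
      forall D : {ffun record d -> R}, is_pmf D ->
        forall w : 'I_d -> R,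
          expected_robust_err M gamma' D <=
            robust_err gamma (halfspace w) D
            + C * (1 / (eps * Num.sqrt n%:R * (gamma - gamma') ^+ 2)
                   + ln (1 / (gamma - gamma')) / (eps ^+ 2 * n%:R * (gamma - gamma'))).
Proof.
move=> R; exists (500 * 1000); split; first by apply: mulr_gt0; rewrite ltr0n.
move=> eps gamma gamma' d n e01 g01 g'01 gg n0.
have /andP[e0 e1] := e01; have /andP[g0 g1] := g01; have /andP[g'0 g'1] := g'01.
set Dl := gamma - gamma'; set N : R := Num.sqrt n%:R.
have Dl0 : 0 < Dl by rewrite subr_gt0.
have Dl1 : Dl <= 1 by rewrite /Dl; lra.
have N0 : 0 < N by rewrite sqrtr_gt0 ltr0n.
have NN : n%:R = N ^+ 2 by rewrite sqr_sqrtr.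
pose u := 1 / (eps * N); pose v := 1 / Dl ^+ 2.
have u0 : 0 < u by rewrite divr_gt0 ?mulr_gt0.
have v1 : 1 <= v by rewrite ler_pdivlMr ?exprn_gt0 // mul1r exprn_ile1 // ltW.
have uvE : 1 / (eps * N * Dl ^+ 2) = u * v by rewrite /u /v; field; rewrite !gt_eqF.
have ln0 : 0 <= ln (1 / Dl) / (eps ^+ 2 * n%:R * Dl).
  rewrite divr_ge0 //; last by rewrite !mulr_ge0 // ?exprn_ge0 // ltW.
  by rewrite ln_ge0 // ler_pdivlMr // mul1r.
suff [M [Mv [MD Me]]] : exists M : mechanism R d n,
    valid_halfspace_mech M /\ nabla0_DP eps M /\
    forall D : {ffun record d -> R}, is_pmf D -> forall w : 'I_d -> R,
      expected_robust_err M gamma' D <= robust_err gamma (halfspace w) D + 500 * 1000 * (u * v).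
  exists M; split=> //; split=> // D Dp w; apply: le_trans (Me D Dp w) _.
  rewrite lerD2l uvE; apply: ler_wpM2l; first by apply: mulr_ge0; rewrite ler0n.
  by rewrite lerDl.
have small := small_dimension d e01 (ltW gg) n0.
have uv0 : 0 <= u * v by rewrite mulr_ge0 // ltW // (lt_le_trans _ v1).
have bound (M : mechanism R d n) E : E <= 500 * 1000 * (u * v) ->
    (valid_halfspace_mech M /\ nabla0_DP eps M /\
    forall D : {ffun record d -> R}, is_pmf D -> forall w : 'I_d -> R,
      expected_robust_err M gamma' D <= robust_err gamma (halfspace w) D + E) ->
    exists M : mechanism R d n, valid_halfspace_mech M /\ nabla0_DP eps M /\
    forall D : {ffun record d -> R}, is_pmf D -> forall w : 'I_d -> R,
      expected_robust_err M gamma' D <= robust_err gamma (halfspace w) D + 500 * 1000 * (u * v).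
  move=> EE [Mv [MD Me]]; exists M; split=> //; split=> // D Dp w.
  by apply: le_trans (Me D Dp w) _; rewrite lerD2l.
(* When [u * v > 1] the bound exceeds 1 and any private mechanism will do. *)
case: (lerP (u * v) 1) => uv1; last first.
  have [M [Mv [MD _]]] := small; exists M; split=> //; split=> // D [D0 D1] w.
  have pmf_le1 (F : record d -> R) : (forall r, F r <= 1) -> \sum_r D r * F r <= 1.
    by move=> F1; rewrite -[leRHS]D1; apply: ler_sum => r _; rewrite ler_piMr.
  have er : expected_robust_err M gamma' D <= 1.
    rewrite -[leRHS](Ex_cst n 1 D1); apply: ler_Ex => // S.
    have [M0 M1] := (Mv S).1; rewrite -[leRHS]M1; apply: ler_sum => h _; rewrite ler_piMr //.
    by apply: pmf_le1 => r; case: ifP.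
  have : 0 <= robust_err gamma (halfspace w) D.
    by apply: sumr_ge0 => r _; rewrite mulr_ge0 //; case: ifP.
  lra.
case: (lerP 3 (Dl * d%:R)) => dDl.
  have [M HM] := large_dimension e01 g01 g'01 n0 dDl; apply: (bound M _ _ HM).
  rewrite -/Dl -/N NN.
  have -> : (6 / eps * N * (1 + 432 / Dl ^+ 2) + 400 * 1000 / eps ^+ 2 / Dl ^+ 4) / N ^+ 2 =
     6 * u * (1 + 432 * v) + 400 * 1000 * ((u * v) * (u * v)).
    by rewrite /u /v; field; rewrite !gt_eqF.
  have := ler_wpM2l uv0 uv1; have := ler_wpM2l (ltW u0) v1; lra.
have [M HM] := small; apply: (bound M _ _ HM).
rewrite -/N NN; set X := d.+1%:R ^+ 2.
have -> : (12 / eps * N * (X + 1) + 6 * X / eps ^+ 2) / N ^+ 2 = 12 * u * (X + 1) + 6 * X * (u * u).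
  by rewrite /u; field; rewrite !gt_eqF.
(* Here [Dl * d < 3] and [Dl <= 1], so [Dl * (d + 1) <= 4]. *)
have X16 : X <= 16 * v.
  rewrite /v mulrA mulr1 ler_pdivlMr ?exprn_gt0 // /X -exprMn.
  have -> : 16 = 4 ^+ 2 :> R by rewrite -natrX.
  rewrite lerXn2r ?nnegrE ?mulr_ge0 ?(ltW Dl0) // -natr1; lra.
have u1 : u <= 1 by apply: le_trans uv1; rewrite ler_peMr // ltW.
have := ler_wpM2l (ltW u0) X16; have := ler_wpM2l (ltW u0) v1.
have := ler_wpM2l (ltW u0) u1; have : 0 <= u * X by rewrite mulr_ge0 ?exprn_ge0 // ltW.
move=> uX0 uu uv uX.
have : u * X * u <= u * X * 1 by apply: ler_wpM2l.
lra.
Qed.
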